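(* Let $1\le m\le n$. (1) Let $\mathbb{F}=\mathbb{R}$ or $\mathbb{F}=\mathbb{H}$ (with $m,n$ even in the case $\mathbb{F}=\mathbb{H}$), and let $H$ be a real Hamiltonian on $T^*\mathrm{Gr}_{\mathbb{F}}$. Let $H^{\mathbb{C}}$ be a holomorphic function on $\mathrm{Orb}(i)$ with $H^{\mathbb{C}}|_{\mathcal{D}_{\mathbb{F}}}=H\circ\Phi|_{\mathcal{D}_{\mathbb{F}}}$, where $\mathcal{D}_{\mathbb{F}}\subset\mathrm{Orb}(i)$ is the imaginary-symplectic form. If $H(\eta)=H(-\eta)$ for all covectors $\eta$, then $H^{\mathbb{C}}$ is purely real on the compact real-symplectic form $\mathcal{D}_{\mathbb{C}}^{\mathrm{unit}}\cong\mathrm{Gr}_{\mathbb{C}}$ of $\mathrm{Orb}(i)$. (2) Let $H$ be a real Hamiltonian on $T^*\mathrm{Gr}_{\mathbb{C}}$. Let $H^{\mathbb{C}}$ be a holomorphic function on $\mathrm{Orb}(i)\times\mathrm{Orb}(i)$ with $H^{\mathbb{C}}|_{\mathrm{Orb}(i)}=H\circ\Phi$, where $\mathrm{Orb}(i)$ is regarded as the imaginary-symplectic form $\{(\xi,-\overline{\xi})\mid\xi\in\mathrm{Orb}(i)\}$ of $\mathrm{Orb}(i)\times\mathrm{Orb}(i)$. If $H(\eta)=H(-\eta)$ for all covectors $\eta$, then $H^{\mathbb{C}}$ is purely real on the compact real-symplectic form $\mathcal{D}_{\mathbb{C}}^{\mathrm{unit}}\times\mathcal{D}_{\mathbb{C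}}^{\mathrm{unit}}\cong\mathrm{Gr}_{\mathbb{C}}\times\mathrm{Gr}_{\mathbb{C}}$.
   Context: $\mathrm{Orb}(i)=\{\xi=QP\mid Q\in\mathbb{C}^{n\times m},\,P\in\mathbb{C}^{m\times n},\ PQ=i\,\mathrm{Id}_m\}$ is a coadjoint orbit of $GL_n\mathbb{C}$ in $\mathfrak{gl}_n\mathbb{C}^*$ (identified with $\mathfrak{gl}_n\mathbb{C}$ by the trace form), with holomorphic symplectic form $\Omega_{\mathrm{KKS}}([\xi,X],[\xi,Y])=\mathrm{Tr}(\xi[X,Y])$. On $\mathrm{Orb}(i)\times\mathrm{Orb}(i)$ one takes $\frac12\Omega_{\mathrm{KKS}}\oplus\frac12\Omega_{\mathrm{KKS}}$. A point $\xi\in\mathrm{Orb}(i)$ corresponds to the decomposition $\mathbb{C}^n=\Sigma\oplus\Lambda$ with $\Sigma=\mathrm{Im}\,\xi$ (dimension $m$), $\Lambda=\ker\xi$. A submanifold $N$ of a holomorphic symplectic manifold $(M,\Omega)$ that is totally real of half dimension is called a real-symplectic (imaginary-symplectic) form if $\Omega|_N$ is purely real (purely imaginary). $\mathcal{D}_{\mathbb{R}}\subset\mathrm{Orb}(i)$ is the set of $\xi$ for which $\Sigma,\Lambda$ are invariant under complex conjugation. For $m,n$ even let $\mathbb{J}(x)=\mathcal{J}\overline{x}$ be a quaternionic structure on $\mathbb{C}^n$, with $\mathcal{J}$ a real skew-symmetric matrix, $\mathcal{J}^2=-\mathrm{Id}$; $\mathcal{D}_{\mathbb{H}}\subset\mathrm{Orb}(i)$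 is the set of $\xi$ for which $\Sigma,\Lambda$ are $\mathbb{J}$-invariant. $\mathcal{D}_{\mathbb{C}}^{\mathrm{unit}}=\{\xi\in\mathrm{Orb}(i)\mid\xi^\dagger=-\xi\}$, i.e. $\Sigma\perp\Lambda$ for the standard (positive definite) Hermitian form; it is identified with $\mathrm{Gr}_{\mathbb{C}}$ via $\xi\mapsto\Sigma$. $\mathrm{Gr}_{\mathbb{C}}$ is the Grassmannian of complex $m$-dimensional subspaces of $\mathbb{C}^n$; $\mathrm{Gr}_{\mathbb{R}}$, $\mathrm{Gr}_{\mathbb{H}}\subset\mathrm{Gr}_{\mathbb{C}}$ are the subsets of subspaces invariant under complex conjugation, respectively $\mathbb{J}$. A covector to $\Pi\in\mathrm{Gr}_{\mathbb{C}}$ is a linear map $\eta:\mathbb{C}^n/\Pi\to\Pi$ (equivalently an $n\times n$ matrix with $\eta(\Pi)=0$, $\mathrm{Im}\,\eta\subset\Pi$), paired by trace with $T_\Pi\mathrm{Gr}_{\mathbb{C}}=\mathrm{Hom}(\Pi,\mathbb{C}^n/\Pi)$. The real cotangent bundle $T^*\mathrm{Gr}_{\mathbb{C}}$ is identified with $T^*_{1,0}\mathrm{Gr}_{\mathbb{C}}$ by taking real parts of covectors, and $T^*\mathrm{Gr}_{\mathbb{R}}$, $T^*\mathrm{Gr}_{\mathbb{H}}$ are the submanifolds of $(\Pi,\eta)$ with $\Pi\in\mathrm{Gr}_{\mathbb{R}}$, $\overline\eta=\eta$, respectively $\Pi\in\mathrm{Gr}_{\mathbb{H}}$, $\eta\mathbb{J}=\mathbb{J}\eta$.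 $\Phi:\mathrm{Orb}(i)\to T^*_{1,0}\mathrm{Gr}_{\mathbb{C}}$ is the diffeomorphism $\Phi(\xi)=(\Pi,\eta)$ with $$\Pi=\{x+\sqrt{\xi^\dagger\xi}\,(x)\mid x\in\mathrm{Im}\,\xi\},\qquad \eta=\tfrac12\big(\sqrt{\xi^\dagger\xi}-\sqrt{\xi\xi^\dagger}-i\xi-i\xi^\dagger\big),$$ the roots being positive-semidefinite; it maps $\mathcal{D}_{\mathbb{R}}$ onto $T^*\mathrm{Gr}_{\mathbb{R}}$ and $\mathcal{D}_{\mathbb{H}}$ onto $T^*\mathrm{Gr}_{\mathbb{H}}$. *)

(* Defs.v *)
From HB Require Import structures.
From mathcomp Require Import all_boot all_order all_algebra.
From mathcomp Require Import complex.
From mathcomp Require Import all_classical all_reals all_analysis.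

Set Implicit Arguments.
Unset Strict Implicit.
Unset Printing Implicit Defensive.

Import Order.TTheory GRing.Theory Num.Theory.
Import numFieldNormedType.Exports.

Local Open Scope classical_set_scope.
Local Open Scope sesquilinear_scope.
Local Open Scope ring_scope.

(* Differentiability is K-linear Frechet differentiability, so for K = R[i]
   it is complex differentiability.  When S is an embedded complex submanifold
   of V (as Orb and Orb `*` Orb are), the functions that locally extend to
   holomorphic functions of the ambient space are exactly the holomorphic
   functions on S. *)
Definition holomorphic_on (K : numFieldType) (V : normedModType K)
    (S : set V) (f : V -> K) : Prop :=
  forall x, S x -> exists (U : set V) (g : V -> K),
    [/\ open U, U x, forall y, U y -> differentiable g y
      & forall y, U y -> S y -> f y = g y].

Section Orbit.
Variables (C : numClosedFieldType) (n : nat).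

Implicit Types (xi eta : 'M[C]_n) (Pi : {vspace 'cV[C]_n}).

(* Matrices act on column vectors from the left, unlike the row-space
   conventions of mxalgebra. *)
Definition mxlin xi : 'End('cV[C]_n) := linfun (mulmx xi).

Definition immx xi : {vspace 'cV[C]_n} := limg (mxlin xi).
Definition kernelmx xi : {vspace 'cV[C]_n} := lker (mxlin xi).

Definition psdmx (A : 'M[C]_n) : Prop :=
  A^t* = A /\ forall x : 'cV[C]_n, 0 <= (x^t* *m A *m x) ord0 ord0.

(* The unique positive semidefinite square root of A, when A is positive
   semidefinite (and a junk value otherwise). *)
Definition sqrtmx (A : 'M[C]_n) : 'M[C]_n :=
  xget 0 [set B | psdmx B /\ B *m B = A].

Definition cmxconj p q (A : 'M[C]_(p, q)) : 'M[C]_(p, q) := map_mx Num.conj A.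

Definition quat_map (JJ : 'M[C]_n) (x : 'cV[C]_n) : 'cV[C]_n :=
  JJ *m cmxconj x.

Definition stable_under (tau : 'cV[C]_n -> 'cV[C]_n) Pi : Prop :=
  forall x, x \in Pi -> tau x \in Pi.

Definition Orb (m : nat) : set 'M[C]_n :=
  [set xi | exists (Q : 'M[C]_(n, m)) (P : 'M[C]_(m, n)),
     P *m Q = 'i%:M /\ xi = Q *m P].

Definition D_R (m : nat) : set 'M[C]_n :=
  [set xi | [/\ Orb m xi, stable_under (@cmxconj n 1) (immx xi)
              & stable_under (@cmxconj n 1) (kernelmx xi)]].

Definition D_H (m : nat) (JJ : 'M[C]_n) : set 'M[C]_n :=
  [set xi | [/\ Orb m xi, stable_under (quat_map JJ) (immx xi)
              & stable_under (quat_map JJ) (kernelmx xi)]].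

Definition D_unit (m : nat) : set 'M[C]_n :=
  [set xi | Orb m xi /\ xi^t* = - xi].

Definition Gr_C (m : nat) : set {vspace 'cV[C]_n} :=
  [set Pi | \dim Pi = m].

Definition Gr_R (m : nat) : set {vspace 'cV[C]_n} :=
  [set Pi | Gr_C m Pi /\ stable_under (@cmxconj n 1) Pi].

Definition Gr_H (m : nat) (JJ : 'M[C]_n) : set {vspace 'cV[C]_n} :=
  [set Pi | Gr_C m Pi /\ stable_under (quat_map JJ) Pi].

(* eta, seen as a linear map C^n / Pi -> Pi. *)
Definition covector Pi eta : Prop :=
  (Pi <= kernelmx eta)%VS /\ (immx eta <= Pi)%VS.

Definition TGr_C (m : nat) : set ({vspace 'cV[C]_n} * 'M[C]_n) :=
  [set p | Gr_C m p.1 /\ covector p.1 p.2].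

Definition TGr_R (m : nat) : set ({vspace 'cV[C]_n} * 'M[C]_n) :=
  [set p | [/\ Gr_R m p.1, covector p.1 p.2 & cmxconj p.2 = p.2]].

Definition TGr_H (m : nat) (JJ : 'M[C]_n) :
    set ({vspace 'cV[C]_n} * 'M[C]_n) :=
  [set p | [/\ Gr_H m JJ p.1, covector p.1 p.2
    & forall x, p.2 *m quat_map JJ x = quat_map JJ (p.2 *m x)]].

Definition Phi xi : {vspace 'cV[C]_n} * 'M[C]_n :=
  ((mxlin (1%:M + sqrtmx (xi^t* *m xi)) @: immx xi)%VS,
   2^-1 *: (sqrtmx (xi^t* *m xi) - sqrtmx (xi *m xi^t*)
            - 'i *: xi - 'i *: xi^t*)).

(* A real Hamiltonian on a cotangent bundle T is a real function on pairs of
   which only the values on T matter. *)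
Definition even_on (R : Type) (T : set ({vspace 'cV[C]_n} * 'M[C]_n))
    (H : {vspace 'cV[C]_n} * 'M[C]_n -> R) : Prop :=
  forall Pi eta, T (Pi, eta) -> H (Pi, eta) = H (Pi, - eta).

End Orbit.

Arguments Orb : clear implicits.
Arguments D_R : clear implicits.
Arguments D_H : clear implicits.
Arguments D_unit : clear implicits.
Arguments TGr_C : clear implicits.
Arguments TGr_R : clear implicits.
Arguments TGr_H : clear implicits.

(* Main.v *)
(* Let [s] be the involution of [Orb] sending [xi] to minus its conjugate
   transpose.  It fixes [D_unit] pointwise, preserves the imaginary-symplectic
   form, and corresponds under [Phi] to [(Pi, eta) |-> (Pi, - eta)].  As [H] is
   even, the holomorphic functions [HC xi] and [conj (HC (s xi))] agree on the imaginary-symplectic form,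
   which is totally real of half dimension, hence everywhere; on [D_unit] this
   says that [HC] is real.

   To see that they agree at a point [xi = Q *m W], with [W *m Q = 'i%:M],
   split [Q = A + 'i *: B] and [W = D + 'i *: E] with respect to the real
   structure.  The curve ['i *: Q(z) *m (W(z) *m Q(z))^-1 *m W(z)], where
   [Q(z) = A + z *: B] and [W(z) = D + z *: E], lies in [Orb], in the
   imaginary-symplectic form for real [z], and passes through [xi] at [z = 'i].
   It is defined off the zeros of the polynomial [\det (W(z) *m Q(z))], so that
   the identity theorem in one variable suffices.

   That theorem is reduced to Goursat's: if [h] is holomorphic near a closed
   square and vanishes on one side, the product of the four functions obtained
   from [h] by rotating the square vanishes on the whole boundary, hence at the
   center by Cauchy's formula.  So zeros propagate from the real axis to discs
   and along chains of discs. *)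

Require Import Defs.
From mathcomp Require Import all_boot all_order all_algebra.
From mathcomp Require Import complex ring lra.
From mathcomp Require Import all_classical all_reals all_analysis.

Set Implicit Arguments.
Unset Strict Implicit.
Unset Printing Implicit Defensive.

Import Order.TTheory GRing.Theory Num.Theory.
Import numFieldNormedType.Exports.
Import ComplexField.Normc.

Local Open Scope classical_set_scope.
Local Open Scope sesquilinear_scope.
Local Open Scope ring_scope.

(** * Positive semidefinite square roots *)

Section Adjoint.
Variable C : numClosedFieldType.

Lemma adjmxM m n p (A : 'M[C]_(m, n)) (B : 'M[C]_(n, p)) :
  (A *m B)^t* = B^t* *m A^t*.
Proof. by rewrite trmx_mul map_mxM. Qed.

Lemma adjmxD m n (A B : 'M[C]_(m, n)) : (A + B)^t* = A^t* + B^t*.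
Proof. by rewrite linearD/= map_mxD. Qed.

Lemma adjmxN m n (A : 'M[C]_(m, n)) : (- A)^t* = - A^t*.
Proof. by rewrite linearN/= map_mxN. Qed.

Lemma adjmxZ m n (a : C) (A : 'M[C]_(m, n)) : (a *: A)^t* = a^* *: A^t*.
Proof. by rewrite linearZ/= map_mxZ. Qed.

Lemma adjmx_scalar n (a : C) : (a%:M : 'M[C]_n)^t* = (a^*)%:M.
Proof. by rewrite tr_scalar_mx map_scalar_mx. Qed.

Lemma cmxconjM m n p (A : 'M[C]_(m, n)) (B : 'M[C]_(n, p)) :
  cmxconj (A *m B) = cmxconj A *m cmxconj B.
Proof. exact: map_mxM. Qed.

Lemma cmxconjD m n (A B : 'M[C]_(m, n)) :
  cmxconj (A + B) = cmxconj A + cmxconj B.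
Proof. exact: map_mxD. Qed.

Lemma cmxconjN m n (A : 'M[C]_(m, n)) : cmxconj (- A) = - cmxconj A.
Proof. exact: map_mxN. Qed.

Lemma cmxconjZ m n (a : C) (A : 'M[C]_(m, n)) :
  cmxconj (a *: A) = a^* *: cmxconj A.
Proof. exact: map_mxZ. Qed.

Lemma cmxconjK m n (A : 'M[C]_(m, n)) : cmxconj (cmxconj A) = A.
Proof. by apply/matrixP => i j; rewrite !mxE conjCK. Qed.

Lemma adjmx_cmxconj m n (A : 'M[C]_(m, n)) : (cmxconj A)^t* = cmxconj (A^t*).
Proof. by apply/matrixP => i j; rewrite !mxE. Qed.

Lemma gram_diag m n (X : 'M[C]_(m, n)) j :
  (X^t* *m X) j j = \sum_i `|X i j| ^+ 2.
Proof.
by rewrite mxE; apply: eq_bigr => i _; rewrite !mxE mulrC normCK.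
Qed.

Lemma trace_gram m n (X : 'M[C]_(m, n)) :
  \tr (X^t* *m X) = \sum_j \sum_i `|X i j| ^+ 2.
Proof. by apply: eq_bigr => j _; rewrite gram_diag. Qed.

Lemma trace_gram_ge0 m n (X : 'M[C]_(m, n)) : 0 <= \tr (X^t* *m X).
Proof.
rewrite trace_gram; apply: sumr_ge0 => j _; apply: sumr_ge0 => i _.
exact: exprn_ge0.
Qed.

Lemma trace_gram_eq0 m n (X : 'M[C]_(m, n)) : \tr (X^t* *m X) = 0 -> X = 0.
Proof.
rewrite trace_gram => /eqP; rewrite psumr_eq0; last first.
  by move=> j _; apply: sumr_ge0 => i _; exact: exprn_ge0.
move=> /allP h; apply/matrixP => i j; rewrite mxE.
have := h j (mem_index_enum _); rewrite psumr_eq0; last by move=> *; exact: exprn_ge0.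
move=> /allP/(_ i (mem_index_enum _)).
by rewrite /= sqrf_eq0 normr_eq0 => /eqP.
Qed.

Lemma gram_eq0 m n (X : 'M[C]_(m, n)) : X^t* *m X = 0 -> X = 0.
Proof. by move=> h; apply: trace_gram_eq0; rewrite h mxtrace0. Qed.

Lemma cogram_eq0 m n (X : 'M[C]_(m, n)) : X *m X^t* = 0 -> X = 0.
Proof.
rewrite -[X in X *m _]trmxCK => /gram_eq0 h.
by rewrite -[X]trmxCK h; apply/matrixP => i j; rewrite !mxE conjC0.
Qed.

Lemma psdmx_gram n (X : 'M[C]_n) : psdmx (X^t* *m X).
Proof.
split=> [|x]; first by rewrite adjmxM trmxCK.
rewrite -mulmxA -mulmxA mulmxA -adjmxM gram_diag; apply: sumr_ge0 => i _.
exact: exprn_ge0.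
Qed.

Lemma adjmx_diag n (d : 'rV[C]_n) : (forall j, 0 <= d ord0 j) ->
  (diag_mx d)^t* = diag_mx d.
Proof.
move=> d0; rewrite tr_diag_mx map_diag_mx; congr diag_mx.
by apply/rowP => j; rewrite mxE; apply: CrealP; exact: ger0_real.
Qed.

(** Spectral theorem: testing positivity on the eigenvectors shows that the eigenvalues are
    nonnegative, and their roots are taken in a unitary eigenbasis. *)
Lemma psdmx_sqrt n (A : 'M[C]_n) : psdmx A -> exists2 B, psdmx B & B *m B = A.
Proof.
move=> [Ah Apos].
have /orthomx_spectralP : A \is normalmx by apply/normalmxP; rewrite Ah.
have /unitarymxP := spectral_unitarymx A.
rewrite invmx_unitary ?spectral_unitarymx//.
set P := spectralmx A; set d := spectral_diag A => PP AE.
have d0 j : 0 <= d ord0 j.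
  have := Apos (P^t* *m delta_mx j ord0).
  rewrite AE adjmxM trmxCK !mulmxA -[_ *m P *m P^t*]mulmxA PP mulmx1.
  rewrite -[_ *m P *m P^t*]mulmxA PP mulmx1.
  rewrite -colE mxE mxE (bigD1 j)//= big1 => [|i ij]; last first.
    by rewrite !mxE eqxx (negPf ij) /= conjC0 mul0r.
  by rewrite !mxE !eqxx /= conjC1 mul1r addr0 mulr1n.
(* The fourth roots [s] exhibit the candidate root as a Gram matrix, which makes it positive
   semidefinite. *)
pose r := map_mx sqrtC d; pose s := map_mx sqrtC r.
have r0 j : 0 <= r ord0 j by rewrite mxE sqrtC_ge0.
have s0 j : 0 <= s ord0 j by rewrite mxE sqrtC_ge0.
have sq (u v : 'rV[C]_n) : (forall j, v ord0 j * v ord0 j = u ord0 j) ->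
    diag_mx v *m diag_mx v = diag_mx u.
  by move=> h; rewrite mulmx_diag; congr diag_mx; apply/rowP => j; rewrite mxE h.
have ss : diag_mx s *m diag_mx s = diag_mx r.
  by apply: sq => j; rewrite !mxE -expr2 sqrtCK.
have rr : diag_mx r *m diag_mx r = diag_mx d.
  by apply: sq => j; rewrite !mxE -expr2 sqrtCK.
exists (P^t* *m diag_mx r *m P).
  have -> : P^t* *m diag_mx r *m P = (diag_mx s *m P)^t* *m (diag_mx s *m P).
    by rewrite adjmxM adjmx_diag// -ss !mulmxA.
  exact: psdmx_gram.
by rewrite [RHS]AE -rr !mulmxA -[_ *m P *m P^t*]mulmxA PP mulmx1.
Qed.

Lemma psdmx_adj n (A : 'M[C]_n) : psdmx A -> A^t* = A.
Proof. by case. Qed.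

(** Writing [B = S *m S] with [S] self-adjoint turns the trace into the squared Hilbert-Schmidt norm
    of [S *m Y]. *)
Lemma psdmx_trace_conj n p (B : 'M[C]_n) (Y : 'M[C]_(n, p)) : psdmx B ->
  0 <= \tr (Y^t* *m B *m Y) /\ (\tr (Y^t* *m B *m Y) = 0 -> B *m Y = 0).
Proof.
move=> /psdmx_sqrt[S /psdmx_adj Sh <-].
have -> : Y^t* *m (S *m S) *m Y = (S *m Y)^t* *m (S *m Y).
  by rewrite adjmxM Sh !mulmxA.
split; first exact: trace_gram_ge0.
by move=> /trace_gram_eq0 h; rewrite -mulmxA h mulmx0.
Qed.

(** The defect [Y = B *m X - X *m A] satisfies [B *m Y + Y *m A = 0]. Multiplying by the adjoint of
    [Y] and taking traces gives two nonnegative terms with sum zero, so [B] kills [Y] and [A] kills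
    its adjoint, whence [Y] has norm zero. The case [X = 1%:M] is uniqueness of the root. *)
Lemma psdmx_sqrt_intertwine n (A B X : 'M[C]_n) : psdmx A -> psdmx B ->
  B *m B *m X = X *m (A *m A) -> B *m X = X *m A.
Proof.
move=> pA pB h; have Ah := psdmx_adj pA; have Bh := psdmx_adj pB.
pose Y := B *m X - X *m A.
have BYYA : B *m Y + Y *m A = 0.
  by rewrite mulmxBr mulmxBl !mulmxA h !mulmxA addrA subrK subrr.
have [b0 bY] := psdmx_trace_conj Y pB.
have [a0 aY] := psdmx_trace_conj (Y^t*) pA; rewrite trmxCK in a0 aY.
have : \tr (Y^t* *m B *m Y) + \tr (Y *m A *m Y^t*) = 0.
  rewrite [\tr (Y *m A *m _)]mxtrace_mulC -mxtraceD -!mulmxA -mulmxDr.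
  by rewrite BYYA mulmx0 mxtrace0.
move=> /eqP; rewrite paddr_eq0// => /andP[/eqP/bY BY /eqP/aY AY].
apply/eqP; rewrite -subr_eq0 -/Y; apply/eqP/trace_gram_eq0.
rewrite {2}/Y mulmxBr raddfB/=.
have YB : Y^t* *m B = 0.
  by rewrite -[LHS]trmxCK adjmxM trmxCK Bh BY trmx0 map_mx0.
rewrite mulmxA YB mul0mx mxtrace0 sub0r mulmxA mxtrace_mulC mulmxA AY mul0mx.
by rewrite mxtrace0 oppr0.
Qed.

Lemma psdmx_sqrt_unique n (A B : 'M[C]_n) : psdmx A -> psdmx B ->
  B *m B = A *m A -> B = A.
Proof.
move=> pA pB h; have := @psdmx_sqrt_intertwine n A B 1%:M pA pB.
by rewrite !mulmx1 !mul1mx => ->.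
Qed.

Lemma sqrtmxP n (A : 'M[C]_n) : psdmx A ->
  psdmx (sqrtmx A) /\ sqrtmx A *m sqrtmx A = A.
Proof.
move=> /psdmx_sqrt[B pB BB]; rewrite /sqrtmx; case: xgetP => [D _ [? ?]//|].
by move=> /(_ B) h; exfalso; exact: h.
Qed.

End Adjoint.

(** * The map Phi and the involution of the orbit *)

Section MatrixMaps.
Variables (C : numClosedFieldType) (n : nat).
Implicit Types (xi : 'M[C]_n) (x : 'cV[C]_n).

Lemma mxlinE xi x : mxlin xi x = xi *m x.
Proof. exact: lfunE. Qed.

Lemma mem_immxP xi x : reflect (exists u, x = xi *m u) (x \in immx xi).
Proof.
apply: (iffP idP) => [/memv_imgP[u _ ->]|[u ->]]; first by exists u; rewrite mxlinE.
by rewrite -mxlinE memv_img ?memvf.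
Qed.

Lemma mem_kernelmx xi x : (x \in kernelmx xi) = (xi *m x == 0).
Proof. by rewrite memv_ker mxlinE. Qed.

Lemma mulmx_colP p q (A B : 'M[C]_(p, q)) : (forall x : 'cV_q, A *m x = B *m x) -> A = B.
Proof.
move=> h; apply/trmx_inj/row_matrixP => i.
by rewrite -!tr_col !colE h.
Qed.

(** Equivalently [- 'i *: xi] is a projection, the form in which membership in the orbit enters the
    study of [Phi]. *)
Lemma Orb_sqr m xi : Orb C n m xi -> xi *m xi = 'i *: xi.
Proof.
move=> [Q [P [PQ ->]]]; rewrite mulmxA -[Q *m P *m Q]mulmxA PQ.
by rewrite mul_mx_scalar -scalemxAl.
Qed.

Lemma Orb_opp_adj m xi : Orb C n m xi -> Orb C n m (- xi^t*).
Proof.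
move=> [Q [P [PQ ->]]]; exists (- P^t*), (Q^t*); split.
  by rewrite mulmxN -adjmxM PQ adjmx_scalar conjCi raddfN opprK.
by rewrite adjmxM mulNmx.
Qed.

(** [P *m Q = 'i%:M] makes [Q] injective and [P] surjective, so the image is that of [Q]. *)
Lemma dim_immx_Orb m xi : Orb C n m xi -> \dim (immx xi) = m.
Proof.
move=> [Q [P [PQ ->]]].
have -> : immx (Q *m P) = (linfun (mulmx Q) @: fullv)%VS.
  apply/vspaceP => x; apply/mem_immxP/memv_imgP => [[u ->]|[v _ ->]].
    by exists (P *m u); rewrite ?memvf// lfunE /= mulmxA.
  exists (- 'i *: (Q *m v)); rewrite lfunE /= -scalemxAr mulmxA -[Q *m P *m Q]mulmxA PQ.
  by rewrite mul_mx_scalar -scalemxAl scalerA mulNr -expr2 sqrCi opprK scale1r.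
rewrite limg_dim_eq ?dimvf ?dim_matrix; first exact: muln1.
apply/eqP; rewrite -subv0; apply/subvP => x; rewrite memv_cap memv_ker lfunE /=.
move=> /andP[_ /eqP/(congr1 (mulmx P))]; rewrite mulmxA PQ mul_scalar_mx mulmx0.
by move=> /eqP; rewrite scaler_eq0 (negPf (neq0Ci C)) memv0.
Qed.

End MatrixMaps.

Section PhiTheory.
Variables (C : numClosedFieldType) (n : nat).
Implicit Types xi : 'M[C]_n.

(** The two moduli of the polar decompositions of [xi]; the involution exchanges them. *)
Notation absr xi := (sqrtmx (xi^t* *m xi)).
Notation absl xi := (sqrtmx (xi *m xi^t*)).

Lemma absrP xi : psdmx (absr xi) /\ absr xi *m absr xi = xi^t* *m xi.
Proof. exact/sqrtmxP/psdmx_gram. Qed.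

Lemma abslP xi : psdmx (absl xi) /\ absl xi *m absl xi = xi *m xi^t*.
Proof. by have := absrP (xi^t*); rewrite trmxCK. Qed.

Lemma opp_adjK xi : - (- xi^t*)^t* = xi.
Proof. by rewrite adjmxN opprK trmxCK. Qed.

Lemma absr_opp_adj xi : absr (- xi^t*) = absl xi.
Proof. by rewrite adjmxN trmxCK mulmxN mulNmx opprK. Qed.

Lemma absl_opp_adj xi : absl (- xi^t*) = absr xi.
Proof. by rewrite adjmxN trmxCK mulmxN mulNmx opprK. Qed.

Lemma absl_intertwine xi : absl xi *m xi = xi *m absr xi.
Proof.
have [pA AA] := absrP xi; have [pB BB] := abslP xi.
by apply: psdmx_sqrt_intertwine => //; rewrite AA BB !mulmxA.
Qed.

Section Square.
Variable xi : 'M[C]_n.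
Hypothesis xi2 : xi *m xi = 'i *: xi.
Let A := absr xi.
Let B := absl xi.

Lemma opp_adj_sqr : (- xi^t*) *m (- xi^t*) = 'i *: (- xi^t*).
Proof. by rewrite mulmxN mulNmx opprK -adjmxM xi2 adjmxZ conjCi scalerN scaleNr. Qed.

(** [xi] acts as ['i] on its image, which contains the image of [B] because
    [B *m B = xi *m xi^t*]. *)
Lemma mulmx_absl : xi *m B = 'i *: B.
Proof.
have [/psdmx_adj Bh BB] := abslP xi; rewrite -/B in Bh BB.
apply/eqP; rewrite -subr_eq0 -mul_scalar_mx -mulmxBl; apply/eqP/cogram_eq0.
rewrite adjmxM Bh mulmxA -[_ *m B *m B]mulmxA BB mulmxA.
by rewrite mulmxBl xi2 mul_scalar_mx subrr !mul0mx.
Qed.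

(** The difference [M] of the two sides satisfies [M *m A = 0]. As [A] and [xi] have the same Gram
    matrix, [xi] then kills the adjoint of [M], and so does [A]; hence [M *m M^t* = 0]. *)
Lemma absl_absr : B *m A = - 'i *: xi.
Proof.
have [/psdmx_adj Ah AA] := absrP xi; have [/psdmx_adj Bh BB] := abslP xi.
rewrite -/A -/B in Ah AA Bh BB.
pose M := B *m A + 'i *: xi.
have Badj : B *m (xi^t* + 'i%:M) = 0.
  rewrite -[LHS]trmxCK adjmxM Bh adjmxD trmxCK adjmx_scalar conjCi mulmxDl.
  by rewrite mulmx_absl mul_scalar_mx scaleNr subrr trmx0 map_mx0.
have MA : M *m A = 0.
  rewrite mulmxDl -mulmxA AA -scalemxAl -absl_intertwine -/B scalemxAr -mulmxDr.
  by rewrite -mul_scalar_mx -mulmxDl mulmxA Badj mul0mx.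
have xM : xi *m M^t* = 0.
  apply: gram_eq0; rewrite adjmxM trmxCK mulmxA -[M *m _ *m xi]mulmxA -AA.
  by rewrite mulmxA MA !mul0mx.
have M0 : M = 0.
  apply: cogram_eq0; rewrite {1}/M mulmxDl -scalemxAl xM scaler0 addr0.
  by rewrite -mulmxA -[A *m _]trmxCK adjmxM trmxCK Ah MA trmx0 map_mx0 mulmx0.
by apply/eqP; rewrite scaleNr -addr_eq0 -/M M0.
Qed.

Lemma absr_absl : A *m B = 'i *: xi^t*.
Proof.
have [/psdmx_adj Ah AA] := absrP xi; have [/psdmx_adj Bh BB] := abslP xi.
have := congr1 (fun X => X^t*) absl_absr.
by rewrite adjmxM Ah Bh adjmxZ rmorphN/= conjCi opprK.
Qed.

Lemma absl_absr_mulmx : B *m A *m xi = xi.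
Proof.
by rewrite absl_absr -scalemxAl xi2 scalerA mulNr -expr2 sqrCi opprK scale1r.
Qed.

End Square.

Lemma absr_mulmx_adj xi : xi *m xi = 'i *: xi ->
  absr xi = 'i *: (xi^t* *m absr xi).
Proof.
move=> xi2; have := mulmx_absl (opp_adj_sqr xi2); rewrite absl_opp_adj mulNmx.
move=> /(congr1 ( *:%R (- 'i))); rewrite scalerN scaleNr opprK scalerA.
by rewrite mulNr -expr2 sqrCi opprK scale1r => ->.
Qed.

Lemma absl_mulmx xi : xi *m xi = 'i *: xi -> absl xi = - 'i *: (xi *m absl xi).
Proof.
by move=> /mulmx_absl->; rewrite scalerA mulNr -expr2 sqrCi opprK scale1r.
Qed.

Lemma mem_Phi1P xi x :
  reflect (exists u, x = (1%:M + absr xi) *m (xi *m u)) (x \in (Phi xi).1).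
Proof.
apply: (iffP memv_imgP) => [[y /mem_immxP[u ->] ->]|[u ->]].
  by exists u; rewrite mxlinE.
by exists (xi *m u); rewrite ?mxlinE//; apply/mem_immxP; exists u.
Qed.

(** For [y] in the image of [xi], [B *m A *m y = y] gives [y + A *m y = A *m y + B *m (A *m y)],
    where [A], [B] are the right and left moduli, and [A *m y] lies in the image of the adjoint. *)
Lemma Phi1_opp_adj_sub xi : xi *m xi = 'i *: xi ->
  ((Phi xi).1 <= (Phi (- xi^t*)).1)%VS.
Proof.
move=> xi2; apply/subvP => x /mem_Phi1P[u ->]; apply/mem_Phi1P.
exists (- 'i *: (absr xi *m (xi *m u))); rewrite absr_opp_adj.
have -> : - xi^t* *m (- 'i *: (absr xi *m (xi *m u))) = absr xi *m (xi *m u).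
  rewrite -scalemxAr mulNmx scaleNr scalerN opprK [in RHS]absr_mulmx_adj//.
  by rewrite -scalemxAl !mulmxA.
by rewrite !mulmxDl !mul1mx mulmxA !mulmxA absl_absr_mulmx// addrC.
Qed.

(** For the subspaces, the inclusion above is applied to [xi] and to its image under the involution.
    For the covectors, the moduli are exchanged and [xi + xi^t*] changes sign. *)
Lemma Phi_opp_adj xi : xi *m xi = 'i *: xi ->
  Phi (- xi^t*) = ((Phi xi).1, - (Phi xi).2).
Proof.
move=> xi2; rewrite [LHS]surjective_pairing; congr pair.
  apply/eqP; rewrite eqEsubv Phi1_opp_adj_sub// andbT.
  by have := Phi1_opp_adj_sub (opp_adj_sqr xi2); rewrite opp_adjK.
rewrite /Phi /= absr_opp_adj absl_opp_adj adjmxN trmxCK -[RHS]scalerN; congr (_ *: _).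
by rewrite !scalerN !opprK !opprD !opprK addrAC [absl xi - _]addrC.
Qed.

(** This form shows why the image lies in [(Phi xi).1]: that subspace is the image under
    [1 + absr xi] of the range of [xi], and also the image under [1 + absl xi] of the range of the
    adjoint. *)
Lemma Phi2E xi : xi *m xi = 'i *: xi -> 2 *: (Phi xi).2 =
  (1%:M + absl xi) *m absr xi - (1%:M + absr xi) *m absl xi.
Proof.
move=> xi2; rewrite /Phi /= scalerA divff ?pnatr_eq0// scale1r.
rewrite !mulmxDl !mul1mx absl_absr// absr_absl// opprD scaleNr.
by rewrite [RHS]addrACA !addrA.
Qed.

Lemma Phi2_kernel xi : xi *m xi = 'i *: xi ->
  (Phi xi).2 *m (1%:M + absr xi) *m xi = 0.
Proof.
move=> xi2; have [pA AA] := absrP xi.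
suff : 2 *: ((Phi xi).2 *m (1%:M + absr xi) *m xi) = 0.
  by move=> /eqP; rewrite scaler_eq0 pnatr_eq0 => /eqP.
rewrite !scalemxAl Phi2E//.
set A := absr xi; set B := absl xi.
have BA : B *m A *m xi = xi by exact: absl_absr_mulmx.
have Bxi : B *m xi = xi *m A by exact: absl_intertwine.
have AAx : A *m A *m xi = A *m B *m xi.
  by rewrite AA absr_absl// -mulmxA xi2 -scalemxAr -scalemxAl.
have BAAx : B *m A *m A *m xi = B *m xi.
  rewrite -(mulmxA _ A) absl_absr// -scalemxAl mulmxA -Bxi -mulmxA xi2.
  by rewrite -scalemxAr scalerA mulNr -expr2 sqrCi opprK scale1r.
have ABAx : A *m B *m A *m xi = A *m xi by rewrite -(mulmxA A) -mulmxA BA.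
(* The product expands into eight terms, which cancel in pairs by the four identities above. *)
rewrite mulmxDr mulmx1 mulmxDl !mulmxBl !mulmxDl !mul1mx.
rewrite BA AAx BAAx ABAx [_ *m _ + B *m xi]addrC [xi + _]addrC.
by rewrite addrA subrK subrr.
Qed.

(** [1 + absr xi] is injective: a kernel vector [x] makes the sum of its squared norm and of a
    nonnegative quadratic form vanish. *)
Lemma Phi1_dim m xi : Orb C n m xi -> \dim (Phi xi).1 = m.
Proof.
move=> oxi; rewrite -(dim_immx_Orb oxi); apply: limg_dim_eq.
apply/eqP; rewrite -subv0; apply/subvP => x; rewrite memv_cap memv_ker mxlinE.
have [[_ Apos] _] := absrP xi.
move=> /andP[_]; rewrite mulmxDl mul1mx => /eqP x0.
suff -> : x = 0 by rewrite memv0.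
apply: trace_gram_eq0; rewrite /mxtrace big_ord1.
have := Apos x; have := congr1 (fun v => (x^t* *m v) ord0 ord0) x0.
rewrite /= mulmxDr mulmx0 mulmxA !mxE => /eqP h pos.
have g0 := trace_gram_ge0 x; rewrite /mxtrace big_ord1 mxE in g0.
by move: h; rewrite paddr_eq0// => /andP[/eqP->].
Qed.

Lemma Phi_covector m xi : Orb C n m xi -> covector (Phi xi).1 (Phi xi).2.
Proof.
move=> /Orb_sqr xi2; split; apply/subvP => x.
  move=> /mem_Phi1P[u ->]; rewrite mem_kernelmx !mulmxA.
  by rewrite Phi2_kernel// mul0mx.
move=> /mem_immxP[u ->].
have -> : (Phi xi).2 *m u = 2^-1 *: ((1%:M + absl xi) *m (absr xi *m u) -
    (1%:M + absr xi) *m (absl xi *m u)).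
  rewrite !(mulmxA _ _ u) -mulmxBl -Phi2E// -scalemxAl scalerA.
  by rewrite divff ?pnatr_eq0// scale1r.
rewrite rpredZ// rpredB//; last first.
  apply/mem_Phi1P; exists (- 'i *: (absl xi *m u)); congr (_ *m _).
  by rewrite {1}absl_mulmx// -scalemxAr -scalemxAl mulmxA.
have := Phi_opp_adj xi2; move=> /(congr1 fst) /= <-.
apply/mem_Phi1P; exists (- 'i *: (absr xi *m u)); rewrite absr_opp_adj; congr (_ *m _).
rewrite {1}absr_mulmx_adj// -scalemxAr -scalemxAl mulmxA mulNmx.
by rewrite mulNmx scaleNr scalerN opprK.
Qed.

Lemma Phi_TGr_C m xi : Orb C n m xi -> TGr_C C n m (Phi xi).
Proof. by move=> oxi; split; [exact: Phi1_dim|exact: Phi_covector oxi]. Qed.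

End PhiTheory.

(** * Compatibility of [Phi] with the antilinear structure [x |-> T *m cmxconj x] *)

Section RealStructure.
Variables (C : numClosedFieldType) (n : nat) (T : 'M[C]_n).
Hypothesis T_unitary : T^t* *m T = 1%:M.
Implicit Types xi : 'M[C]_n.

Let TTadj : T *m T^t* = 1%:M. Proof. exact: mulmx1C. Qed.

(* [xi] anticommutes with the antilinear structure because [- 'i *: xi], the
   projection onto [immx xi], commutes with it. *)
Lemma D_H_anticommute m xi : D_H C n m T xi -> xi *m T = - (T *m cmxconj xi).
Proof.
move=> [/Orb_sqr xi2 simm sker]; apply: mulmx_colP => x.
pose y : 'cV[C]_n := cmxconj x.
have yK : cmxconj y = x by exact: cmxconjK.
(* The structure preserves the image of [xi], on which [xi] is multiplication by ['i]; the
   complementary projection of [y] is treated next, in the kernel. *)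
have im : xi *m quat_map T (xi *m y) = 'i *: quat_map T (xi *m y).
  have /simm/mem_immxP[u ->] : xi *m y \in immx xi by apply/mem_immxP; exists y.
  by rewrite mulmxA xi2 scalemxAl.
have : y + 'i *: (xi *m y) \in kernelmx xi.
  rewrite mem_kernelmx mulmxDr -scalemxAr mulmxA xi2 -scalemxAl scalerA.
  by rewrite -expr2 sqrCi scaleN1r subrr.
move=> /sker; rewrite mem_kernelmx => /eqP.
have -> : quat_map T (y + 'i *: (xi *m y)) = T *m x - 'i *: quat_map T (xi *m y).
  by rewrite /quat_map cmxconjD cmxconjZ conjCi cmxconjM yK mulmxDr -scalemxAr scaleNr.
rewrite mulmxBr -scalemxAr im scalerA -expr2 sqrCi scaleN1r opprK.
move=> /eqP; rewrite addr_eq0 => /eqP; rewrite mulmxA => ->.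
by rewrite /quat_map cmxconjM yK mulNmx mulmxA.
Qed.

Lemma anticommute_D_H m xi : Orb C n m xi -> xi *m T = - (T *m cmxconj xi) ->
  D_H C n m T xi.
Proof.
move=> oxi h; have Tx x : T *m cmxconj (xi *m x) = - (xi *m (T *m cmxconj x)).
  by rewrite cmxconjM mulmxA mulmxA h mulNmx opprK.
split=> // x.
  move=> /mem_immxP[u ->]; apply/mem_immxP; exists (- (T *m cmxconj u)).
  by rewrite /quat_map Tx mulmxN.
rewrite !mem_kernelmx /quat_map => /eqP x0; rewrite -oppr_eq0 -Tx x0.
by rewrite /cmxconj map_mx0 mulmx0.
Qed.

Lemma anticommute_adj xi : xi *m T = - (T *m cmxconj xi) ->
  xi^t* *m T = - (T *m cmxconj (xi^t*)).
Proof.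
move=> /(congr1 (fun X => T *m X^t* *m T)).
rewrite adjmxM adjmxN adjmxM adjmx_cmxconj mulmxA TTadj mul1mx => ->.
by rewrite mulmxN mulNmx mulmxA -(mulmxA _ (T^t*)) T_unitary mulmx1.
Qed.

Lemma D_H_opp_adj m xi : D_H C n m T xi -> D_H C n m T (- xi^t*).
Proof.
move=> dxi; have [oxi _ _] := dxi.
apply: anticommute_D_H; first exact: Orb_opp_adj.
rewrite mulNmx (anticommute_adj (D_H_anticommute dxi)).
by rewrite cmxconjN mulmxN.
Qed.

Lemma psdmx_conj (A : 'M[C]_n) : psdmx A -> psdmx (cmxconj A).
Proof.
move=> [Ah Apos]; split; first by rewrite adjmx_cmxconj Ah.
move=> x; have := Apos (cmxconj x); rewrite -conjC_ge0.
have <- : cmxconj ((cmxconj x)^t* *m A *m cmxconj x) ord0 ord0 =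
    (((cmxconj x)^t* *m A *m cmxconj x) ord0 ord0)^* by rewrite [LHS]mxE.
by rewrite !cmxconjM -adjmx_cmxconj !cmxconjK.
Qed.

(** Conjugating the root by the structure gives another positive semidefinite root of [A], so
    uniqueness applies. *)
Lemma sqrtmx_commute (A : 'M[C]_n) : psdmx A -> A *m T = T *m cmxconj A ->
  sqrtmx A *m T = T *m cmxconj (sqrtmx A).
Proof.
move=> pA AT; have [pS SS] := sqrtmxP pA.
suff : T *m cmxconj (sqrtmx A) *m T^t* = sqrtmx A.
  by move=> {1}<-; rewrite -mulmxA T_unitary mulmx1.
apply: psdmx_sqrt_unique => //.
  have [ch cpos] := psdmx_conj pS; split.
    by rewrite !adjmxM trmxCK ch mulmxA.
  by move=> x; have := cpos (T^t* *m x); rewrite adjmxM trmxCK !mulmxA.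
rewrite !mulmxA -(mulmxA _ (T^t*) T) T_unitary mulmx1.
by rewrite -(mulmxA T) -cmxconjM SS -AT -mulmxA TTadj mulmx1.
Qed.

Lemma absr_commute xi : xi *m T = - (T *m cmxconj xi) ->
  sqrtmx (xi^t* *m xi) *m T = T *m cmxconj (sqrtmx (xi^t* *m xi)).
Proof.
move=> h; apply: sqrtmx_commute; first exact: psdmx_gram.
rewrite -mulmxA h mulmxN mulmxA (anticommute_adj h) mulNmx opprK.
by rewrite cmxconjM mulmxA.
Qed.

(** The moduli commute with the structure; so does ['i *: xi], since both ['i] and [xi] change sign
    across it. *)
Lemma Phi_TGr_H m xi : D_H C n m T xi -> TGr_H C n m T (Phi xi).
Proof.
move=> dxi; have [oxi _ _] := dxi; have h := D_H_anticommute dxi.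
have hA := absr_commute h; have h' := anticommute_adj h.
have hB : sqrtmx (xi *m xi^t*) *m T = T *m cmxconj (sqrtmx (xi *m xi^t*)).
  by have := absr_commute h'; rewrite trmxCK.
split; [split|exact: Phi_covector oxi|].
- exact: Phi1_dim.
- move=> x /mem_Phi1P[u ->]; apply/mem_Phi1P; exists (- (T *m cmxconj u)).
  rewrite /quat_map !cmxconjM mulmxN mulmxA (mulmxA xi) h mulNmx opprK !mulmxA.
  congr (_ *m _ *m _); rewrite mulmxDl mul1mx hA cmxconjD mulmxDr.
  by rewrite {1}/cmxconj map_mx1 mulmx1.
- suff hE : (Phi xi).2 *m T = T *m cmxconj (Phi xi).2.
    by move=> x; rewrite /quat_map cmxconjM !mulmxA hE.
  rewrite /Phi /= cmxconjZ !cmxconjD !cmxconjN !cmxconjZ conjCi.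
  have -> : (2^-1 : C)^* = 2^-1 by apply: conj_Creal; rewrite realV realn.
  rewrite -scalemxAl -scalemxAr; congr (_ *: _).
  rewrite !mulmxDl !mulmxDr !mulNmx !mulmxN hA hB -!scalemxAl -!scalemxAr h h'.
  by rewrite !scaleNr !scalerN !opprK.
Qed.

End RealStructure.
(** * Goursat's theorem on a square *)

Local Open Scope complex_scope.
Local Open Scope ring_scope.

Local Notation Re := (@complex.Re _).
Local Notation Im := (@complex.Im _).

(** * The complex modulus as a real number *)

Section Modulus.
Variable R : realType.
Implicit Types z w : R[i].

Lemma normcE z : `|z| = (normc z)%:C. Proof. by []. Qed.

Lemma normc_ge0 z : 0 <= normc z.
Proof. by rewrite -ler0c -normcE. Qed.

Lemma normc_Complex (a b : R) : normc (a +i* b) = Num.sqrt (a ^+ 2 + b ^+ 2).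
Proof. by []. Qed.

Lemma sqr_normc_ReIm z : normc z ^+ 2 = Re z ^+ 2 + Im z ^+ 2.
Proof. by case: z => a b; rewrite sqr_sqrtr ?addr_ge0 ?sqr_ge0. Qed.

Lemma normc_le_sqr z (r : R) : 0 <= r ->
  Re z ^+ 2 + Im z ^+ 2 <= r ^+ 2 -> normc z <= r.
Proof.
by move=> r0 h; rewrite -(@ler_sqr R) ?nnegrE ?normc_ge0// sqr_normc_ReIm.
Qed.

Lemma Re_le_normc z : `|Re z| <= normc z.
Proof.
rewrite -(@ler_sqr R) ?nnegrE ?normc_ge0// sqr_normc_ReIm -normrX ger0_norm.
  by rewrite lerDl sqr_ge0.
exact: sqr_ge0.
Qed.

Lemma Im_le_normc z : `|Im z| <= normc z.
Proof.
rewrite -(@ler_sqr R) ?nnegrE ?normc_ge0// sqr_normc_ReIm -normrX ger0_norm.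
  by rewrite lerDr sqr_ge0.
exact: sqr_ge0.
Qed.

Lemma normc_le_ReIm z : normc z <= `|Re z| + `|Im z|.
Proof.
apply: normc_le_sqr; first by rewrite addr_ge0.
rewrite -[Re z ^+ 2]real_normK ?num_real// -[Im z ^+ 2]real_normK ?num_real//.
by have := normr_ge0 (Re z); have := normr_ge0 (Im z); nra.
Qed.

Lemma normcD z w : normc (z + w) <= normc z + normc w.
Proof. exact: (@le_normcD R). Qed.

Lemma normc_opp z : normc (- z) = normc z.
Proof. exact: (@normcN R). Qed.

Lemma normcB z w : normc (z - w) = normc (w - z).
Proof. by rewrite -normc_opp opprB. Qed.

Lemma normc_real (x : R) : normc x%:C = `|x|.
Proof. by rewrite normc_Complex expr0n/= addr0 sqrtr_sqr. Qed.

Lemma normc_i : normc ('i : R[i])%C = 1.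
Proof. by rewrite normc_Complex expr0n/= add0r expr1n sqrtr1. Qed.

Lemma normc_conj z : normc z^*%C = normc z.
Proof. by case: z => a b; rewrite !normc_Complex sqrrN. Qed.

Lemma ReD z w : Re (z + w) = Re z + Re w.
Proof. by case: z w => [a b] [c d]. Qed.
Lemma ImD z w : Im (z + w) = Im z + Im w.
Proof. by case: z w => [a b] [c d]. Qed.
Lemma ReN z : Re (- z) = - Re z. Proof. by case: z. Qed.
Lemma ImN z : Im (- z) = - Im z. Proof. by case: z. Qed.
Lemma ReM z w : Re (z * w) = Re z * Re w - Im z * Im w.
Proof. by case: z w => [a b] [c d]. Qed.
Lemma ImM z w : Im (z * w) = Re z * Im w + Im z * Re w.
Proof. by case: z w => [a b] [c d]. Qed.

Lemma complex_ext z w : Re z = Re w -> Im z = Im w -> z = w.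
Proof. by case: z w => [a b] [c d] /= -> ->. Qed.

End Modulus.

(** * Integrals of complex-valued functions over real segments *)

Section SegmentIntegral.
Variable R : realType.
Notation mu := (@lebesgue_measure R).

Definition segcont (f : R -> R[i]) (a b : R) :=
  {within `[a, b], continuous (fun t => Re (f t))} /\
  {within `[a, b], continuous (fun t => Im (f t))}.

Definition cint (f : R -> R[i]) (a b : R) : R[i] :=
  (\int[mu]_(t in `[a, b]) Re (f t)) +i* (\int[mu]_(t in `[a, b]) Im (f t)).

Lemma segcontP (f : R -> R[i]) a b :
  (forall x, a <= x <= b -> forall e, 0 < e -> exists2 d, 0 < d &
     forall y, a <= y <= b -> `|y - x| < d -> normc (f y - f x) < e) ->
  segcont f a b.
Proof.
move=> h; split; apply/subspace_continuousP => x /=; rewrite in_itv/= => xab;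
  apply/cvgrPdist_lt => e e0; have [d d0 hd] := h x xab e e0;
  rewrite near_withinE; near=> y; rewrite /= in_itv/= => yab;
  (have yd : `|y - x| < d by rewrite distrC; near: y; exact: cvgr_dist_lt);
  have := hd y yab yd; rewrite normcB; apply: le_lt_trans.
  by rewrite -ReN -ReD Re_le_normc.
by rewrite -ImN -ImD Im_le_normc.
Unshelve. all: by end_near.
Qed.

Lemma within_integrable (f : R -> R) (a b : R) :
  {within `[a, b], continuous f} -> mu.-integrable `[a, b] (EFin \o f).
Proof.
by move=> cf; apply: continuous_compact_integrable => //; exact: segment_compact.
Qed.

Lemma Rint_split (f : R -> R) (a b c : R) : a <= b -> b <= c ->
  {within `[a, c], continuous f} ->
  \int[mu]_(t in `[a, c]) f t =
  \int[mu]_(t in `[a, b]) f t + \int[mu]_(t in `[b, c]) f t.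
Proof.
move=> ab bc cf.
have := @Rintegral_itvB R f (BLeft a) (BRight c) b (within_integrable cf).
rewrite !bnd_simp => /(_ ab bc) e.
rewrite -[X in _ + X]Rintegral_itv_obnd_cbnd; first by rewrite -e addrC subrK.
apply: integrableS (within_integrable cf) => //.
by move=> x /=; rewrite !in_itv/= => /andP[? ?]; apply/andP; split; lra.
Qed.

Lemma Rint_cst (a b c : R) : a <= b ->
  \int[mu]_(t in `[a, b]) c = c * (b - a).
Proof.
move=> ab; rewrite Rintegral_cst//= lebesgue_measure_itv/= lte_fin.
by case: ltgtP ab => [//|//|->]; rewrite subrr.
Qed.

Lemma Rint_id (a b : R) : a <= b ->
  \int[mu]_(t in `[a, b]) t = (b ^+ 2 - a ^+ 2) / 2.
Proof.
rewrite le_eqVlt => /predU1P[->|ab].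
  by rewrite set_itv1 Rintegral_set1 subrr mul0r.
have dF (x : R) : is_derive x 1 (fun t : R => t ^+ 2 / 2) x.
  have -> : (fun t : R => t ^+ 2 / 2) = (fun t : R => 2^-1 *: t ^+ 2).
    by apply/funext => t; rewrite mulrC.
  by apply: is_derive_eq; rewrite /GRing.scale/= !mulr1; field.
rewrite /Rintegral (@continuous_FTC2 R (fun t => t) (fun t => t ^+ 2 / 2))//=.
- by rewrite mulrBl.
- by apply: continuous_subspaceT => x; exact: cvg_id.
- have cF x : {for x, continuous (fun t : R => t ^+ 2 / 2)}.
    by apply/differentiable_continuous/derivable1_diffP; exact: ex_derive.
  split; first by move=> x _; exact: ex_derive.
    by apply: cvg_at_right_filter; exact: cF.
  by apply: cvg_at_left_filter; exact: cF.
- by move=> x _; rewrite derive1E derive_val.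
Qed.

Lemma cint_split (f : R -> R[i]) (a b c : R) : a <= b -> b <= c ->
  segcont f a c -> cint f a c = cint f a b + cint f b c.
Proof.
move=> ab bc [fR fI].
by rewrite /cint (Rint_split ab bc fR) (Rint_split ab bc fI).
Qed.

Lemma cintB (f g : R -> R[i]) a b :
  segcont f a b -> segcont g a b ->
  cint (fun t => f t - g t) a b = cint f a b - cint g a b.
Proof.
move=> [fR fI] [gR gI]; rewrite /cint; apply: complex_ext => /=.
  under eq_Rintegral do rewrite ReD ReN.
  by rewrite RintegralB//; exact: within_integrable.
under eq_Rintegral do rewrite ImD ImN.
by rewrite RintegralB//; exact: within_integrable.
Qed.

Lemma eq_cint (f g : R -> R[i]) a b :
  (forall t, a <= t <= b -> f t = g t) -> cint f a b = cint g a b.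
Proof.
by move=> fg; rewrite /cint; congr (_ +i* _); apply: eq_Rintegral => t;
  rewrite inE/= in_itv/= => tab; rewrite fg.
Qed.

Lemma Rint_le (f : R -> R) (a b M : R) : a <= b ->
  {within `[a, b], continuous f} ->
  (forall t, a <= t <= b -> `|f t| <= M) ->
  `|\int[mu]_(t in `[a, b]) f t| <= M * (b - a).
Proof.
move=> ab cf fM; rewrite -(Rint_cst M ab).
have fi := within_integrable cf.
apply: (le_trans (le_normr_Rintegral _ fi)) => //.
apply: le_Rintegral => //.
- apply: (@within_integrable (fun t => `|f t|)) => x.
  by apply: continuous_comp (cf x) _; exact: norm_continuous.
- by apply: (@within_integrable (fun=> M)) => x; exact: cst_continuous.
Qed.

(** The factor [2] comes from estimating real and imaginary parts separately; the sharp constant is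
    irrelevant to Goursat's argument. *)
Lemma cint_le (f : R -> R[i]) (a b M : R) : a <= b -> segcont f a b ->
  (forall t, a <= t <= b -> normc (f t) <= M) ->
  normc (cint f a b) <= 2 * M * (b - a).
Proof.
move=> ab [fR fI] fM; apply: (le_trans (normc_le_ReIm _)).
rewrite -mulrA mulr_natl mulr2n; apply: lerD.
  by apply: Rint_le => // t /fM; apply: le_trans; exact: Re_le_normc.
by apply: Rint_le => // t /fM; apply: le_trans; exact: Im_le_normc.
Qed.

Lemma cint_affine (al be : R[i]) a b : a <= b ->
  cint (fun t => al + be * t%:C) a b =
  al * (b - a)%:C + be * ((b ^+ 2 - a ^+ 2) / 2)%:C.
Proof.
move=> ab; have it : mu.-integrable `[a, b] (EFin \o (fun t : R => t)).
  apply: (@within_integrable id); apply: continuous_subspaceT => x; exact: cvg_id.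
have ic (c : R) : mu.-integrable `[a, b] (EFin \o (fun t : R => c)).
  by apply: (@within_integrable (fun=> c)) => x; exact: cst_continuous.
have key (p q : R) : \int[mu]_(t in `[a, b]) (p + q * t) =
    p * (b - a) + q * ((b ^+ 2 - a ^+ 2) / 2).
  rewrite RintegralD//; last first.
    apply: (@within_integrable (fun t => q * t)); apply: continuous_subspaceT => x.
    by apply: cvgM; [exact: cvg_cst|exact: cvg_id].
  by rewrite RintegralZl// Rint_id// Rint_cst.
apply: complex_ext => /=.
  under eq_Rintegral do rewrite ReD ReM /= mulr0 subr0.
  by rewrite key ReD !ReM /= !mulr0 !subr0.
under eq_Rintegral do rewrite ImD ImM /= mulr0 add0r.
by rewrite key ImD !ImM /= !mulr0 !add0r.
Qed.

End SegmentIntegral.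

(** * Contour integrals around rectangles and Goursat's theorem *)

Section Goursat.
Variable R : realType.
Implicit Types (f : R[i] -> R[i]) (a b c d : R).

Definition rect a b c d : set R[i] :=
  [set z | a <= Re z <= b /\ c <= Im z <= d].

Definition relcont (A : set R[i]) f := forall z, A z -> forall e, 0 < e ->
  exists2 d, 0 < d & forall w, A w -> normc (w - z) < d ->
    normc (f w - f z) < e.

Definition cderiv f (z l : R[i]) := forall e, 0 < e -> exists2 d, 0 < d &
  forall w, normc (w - z) < d ->
    normc (f w - f z - l * (w - z)) <= e * normc (w - z).

Definition cdiff f z := exists l, cderiv f z l.

(** The counterclockwise contour integral: [dz] is [dt] on horizontal sides and ['i dt] on vertical
    ones. *)
Definition bint f a b c d : R[i] :=
  cint (fun t => f (t +i* c)) a b - cint (fun t => f (t +i* d)) a b +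
  'i%C * (cint (fun t => f (b +i* t)) c d - cint (fun t => f (a +i* t)) c d).

Lemma relcontW (A B : set R[i]) f : A `<=` B -> relcont B f -> relcont A f.
Proof.
move=> AB cf z /AB Bz e /(cf z Bz)[d d0 h].
by exists d => // w /AB; exact: h.
Qed.

Lemma segcont_hor f a b c d y : c <= y <= d -> relcont (rect a b c d) f ->
  segcont (fun t => f (t +i* y)) a b.
Proof.
move=> cyd cf; apply: segcontP => x xab e e0.
have [//|de de0 h] := cf (x +i* y) _ e e0.
exists de => // z zab zx; apply: h => //.
suff -> : (z +i* y) - (x +i* y) = (z - x)%:C by rewrite normc_real.
by apply: complex_ext => //=; rewrite subrr.
Qed.

Lemma segcont_ver f a b c d x : a <= x <= b -> relcont (rect a b c d) f ->
  segcont (fun t => f (x +i* t)) c d.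
Proof.
move=> axb cf; apply: segcontP => y ycd e e0.
have [//|de de0 h] := cf (x +i* y) _ e e0.
exists de => // z zab zx; apply: h => //.
suff -> : (x +i* z) - (x +i* y) = 'i%C * (z - y)%:C.
  by rewrite normcM normc_real normc_i mul1r.
by apply: complex_ext => /=; ring.
Qed.

Lemma bint_splitx f a m b c d : a <= m <= b -> c <= d ->
  relcont (rect a b c d) f ->
  bint f a b c d = bint f a m c d + bint f m b c d.
Proof.
move=> /andP[am mb] cd cf; rewrite /bint.
rewrite !(@cint_split _ _ a m b)//; last 2 first.
- by apply: (segcont_hor _ cf); rewrite lexx cd.
- by apply: (segcont_hor _ cf); rewrite lexx cd.
by ring.
Qed.

Lemma bint_splity f a b c m d : c <= m <= d -> a <= b ->
  relcont (rect a b c d) f ->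
  bint f a b c d = bint f a b c m + bint f a b m d.
Proof.
move=> /andP[cm md] ab cf; rewrite /bint.
rewrite !(@cint_split _ _ c m d)//; last 2 first.
- by apply: (segcont_ver _ cf); rewrite lexx ab.
- by apply: (segcont_ver _ cf); rewrite lexx ab.
by ring.
Qed.

Lemma bintB f g a b c d : a <= b -> c <= d ->
  relcont (rect a b c d) f -> relcont (rect a b c d) g ->
  bint (fun z => f z - g z) a b c d = bint f a b c d - bint g a b c d.
Proof.
move=> ab cd cf cg; rewrite /bint.
rewrite !cintB; last first.
all: try by [apply: (segcont_hor _ cf); rewrite lexx cd
  | apply: (segcont_hor _ cg); rewrite lexx cd
  | apply: (segcont_ver _ cf); rewrite lexx ab
  | apply: (segcont_ver _ cg); rewrite lexx ab].
by ring.
Qed.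

Lemma bint_le f a b c d (M : R) : a <= b -> c <= d ->
  relcont (rect a b c d) f ->
  (forall z, rect a b c d z -> normc (f z) <= M) ->
  normc (bint f a b c d) <= 4 * M * (b - a) + 4 * M * (d - c).
Proof.
move=> ab cd cf fM; rewrite /bint.
have h1 y : c <= y <= d -> normc (cint (fun t => f (t +i* y)) a b) <= 2 * M * (b - a).
  move=> ycd; apply: cint_le => //; first exact: segcont_hor ycd cf.
  by move=> t tab; apply: fM.
have h2 x : a <= x <= b -> normc (cint (fun t => f (x +i* t)) c d) <= 2 * M * (d - c).
  move=> xab; apply: cint_le => //; first exact: segcont_ver xab cf.
  by move=> t tab; apply: fM.
apply: (le_trans (normcD _ _)); rewrite normcM normc_i mul1r.
apply: lerD; apply: (le_trans (normcD _ _)); rewrite normc_opp.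
  by have := h1 c; have := h1 d; rewrite !lexx cd => /(_ isT) ? /(_ isT) ?; lra.
by have := h2 a; have := h2 b; rewrite !lexx ab => /(_ isT) ? /(_ isT) ?; lra.
Qed.

Lemma relcont_affine (A : set R[i]) (al be : R[i]) :
  relcont A (fun z => al + be * z).
Proof.
move=> z _ e e0; exists (e / (normc be + 1)).
  by rewrite divr_gt0// ltr_pwDr// normc_ge0.
move=> w _; rewrite ltr_pdivlMr ?ltr_pwDr ?normc_ge0// => h.
rewrite opprD addrACA subrr add0r -mulrBr normcM.
by have := normc_ge0 (w - z); nra.
Qed.

Lemma relcontB (A : set R[i]) f g : relcont A f -> relcont A g ->
  relcont A (fun z => f z - g z).
Proof.
move=> cf cg z Az e e0; have e20 : 0 < e / 2 by rewrite divr_gt0.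
have [d1 d10 h1] := cf z Az _ e20; have [d2 d20 h2] := cg z Az _ e20.
exists (Num.min d1 d2); first by rewrite lt_min d10.
move=> w Aw; rewrite lt_min => /andP[/(h1 w Aw) k1 /(h2 w Aw) k2].
rewrite [_ - _](_ : _ = (f w - f z) - (g w - g z)); last by ring.
by apply: (le_lt_trans (normcD _ _)); rewrite normc_opp; lra.
Qed.

Lemma bint_affine (al be : R[i]) a b c d : a <= b -> c <= d ->
  bint (fun z => al + be * z) a b c d = 0.
Proof.
move=> ab cd; rewrite /bint.
have e1 y : cint (fun t => al + be * (t +i* y)) a b =
    (al + be * 'i%C * y%:C) * (b - a)%:C + be * ((b ^+ 2 - a ^+ 2) / 2)%:C.
  rewrite -cint_affine//; apply: eq_cint => t _.
  by rewrite [t +i* y]complexE /=; ring.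
have e2 x : cint (fun t => al + be * (x +i* t)) c d =
    (al + be * x%:C) * (d - c)%:C + be * 'i%C * ((d ^+ 2 - c ^+ 2) / 2)%:C.
  rewrite -cint_affine//; apply: eq_cint => t _.
  by rewrite [x +i* t]complexE /=; ring.
rewrite !e1 !e2 !rmorphB/=.
have i2 : 'i%C * 'i%C = -1 :> R[i] by rewrite -expr2 sqr_i.
set I := 'i%C in i2 *; ring: i2.
Qed.

Lemma nested_intervals (x s : nat -> R) : (forall k, 0 <= s k) ->
  (forall k, x k <= x k.+1) -> (forall k, x k.+1 + s k.+1 <= x k + s k) ->
  exists p, forall k, x k <= p <= x k + s k.
Proof.
move=> s0 xS sS.
have xm k j : (k <= j)%N -> x k <= x j.
  move=> /subnK <-; elim: (j - k)%N => // i ih.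
  by rewrite addSn; exact: le_trans ih (xS _).
have sm k j : (k <= j)%N -> x j + s j <= x k + s k.
  move=> /subnK <-; elim: (j - k)%N => // i ih.
  by rewrite addSn; exact: le_trans (sS _) ih.
have ub k : ubound (range x) (x k + s k).
  move=> _ [j _ <-]; case: (leqP k j) => [kj|/ltnW jk].
    by apply: le_trans (sm _ _ kj); rewrite lerDl.
  by apply: (le_trans (xm _ _ jk)); rewrite lerDl.
have ne : range x !=set0 by exists (x 0%N), 0%N.
exists (sup (range x)) => k; apply/andP; split; last exact: ge_sup.
by apply: ub_le_sup; [exists (x 0%N + s 0%N)|exists k].
Qed.

Lemma exists_halfpow_lt (s e : R) : 0 < s -> 0 < e -> exists k : nat, s / 2 ^+ k < e.
Proof.
move=> s0 e0; have se0 : 0 <= s / e by rewrite ltW// divr_gt0.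
exists (Num.bound (s / e)); rewrite ltr_pdivrMr ?exprn_gt0//.
rewrite mulrC -ltr_pdivrMr//; apply: (lt_le_trans (archi_boundP se0)).
by rewrite -natrX ler_nat ltnW// ltn_expl.
Qed.

(** Keeping a bad quarter at every stage gives nested squares whose sides are halved; their common
    point is found one coordinate at a time. *)
Lemma square_bisection (bad : R -> R -> R -> Prop) (x0 y0 s0 : R) : 0 < s0 ->
  bad x0 y0 s0 ->
  (forall x y s, 0 < s -> x0 <= x -> x + (s + s) <= x0 + s0 ->
    y0 <= y -> y + (s + s) <= y0 + s0 -> bad x y (s + s) ->
    [\/ bad x y s, bad (x + s) y s, bad x (y + s) s | bad (x + s) (y + s) s]) ->
  exists px py, [/\ x0 <= px <= x0 + s0, y0 <= py <= y0 + s0 &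
    forall e, 0 < e -> exists x y s, [/\ 0 < s, s < e, bad x y s,
      [/\ x0 <= x, x + s <= x0 + s0, y0 <= y & y + s <= y0 + s0] &
      x <= px <= x + s /\ y <= py <= y + s]].
Proof.
move=> s00 bad0 badS.
(* The last quarter is chosen without a test: some quarter of a bad square is bad, so it is bad when
   the other three are not. *)
pose next (q : R * R * R) : R * R * R :=
  let: (x, y, s) := q in let h := s / 2 in
  if `[< bad x y h >] then (x, y, h) else
  if `[< bad (x + h) y h >] then (x + h, y, h) else
  if `[< bad x (y + h) h >] then (x, y + h, h) else (x + h, y + h, h).
pose Q k := iter k next (x0, y0, s0).
pose X k := (Q k).1.1; pose Y k := (Q k).1.2; pose S k := (Q k).2.
have nextE k : Q k.+1 = next (X k, Y k, S k).
  by rewrite /Q iterS /X /Y /S -/(Q k); case: (Q k) => -[].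
have SE k : S k = s0 / 2 ^+ k.
  elim: k => [|k ih]; first by rewrite expr0 divr1.
  rewrite {1}/S nextE /next exprSr invfM mulrA -ih.
  by do ![case: ifP => // _].
have S_gt0 k : 0 < S k by rewrite SE divr_gt0// exprn_gt0.
have step k : [/\ X k <= X k.+1, X k.+1 + S k.+1 <= X k + S k,
    Y k <= Y k.+1 & Y k.+1 + S k.+1 <= Y k + S k].
  rewrite {2 3}/X {2 3}/Y {1 3}/S nextE /next; have := S_gt0 k.
  by do ![case: ifP => _]; move=> ? /=; split; lra.
have [px hx] : exists p, forall k, X k <= p <= X k + S k.
  by apply: nested_intervals => k; [exact: ltW|by have [] := step k|by have [] := step k].
have [py hy] : exists p, forall k, Y k <= p <= Y k + S k.
  by apply: nested_intervals => k; [exact: ltW|by have [] := step k|by have [] := step k].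
have inside k : [/\ x0 <= X k, X k + S k <= x0 + s0, y0 <= Y k &
    Y k + S k <= y0 + s0].
  elim: k => [|k [? ? ? ?]]; first by split.
  by have [? ? ? ?] := step k; split; lra.
have badQ k : bad (X k) (Y k) (S k).
  elim: k => [//|k ih]; have [i1 i2 i3 i4] := inside k.
  have SS : S k = S k / 2 + S k / 2 by lra.
  have := badS (X k) (Y k) (S k / 2); rewrite -SS.
  move=> /(_ _ i1 i2 i3 i4 ih); rewrite divr_gt0// => /(_ isT).
  rewrite /X /Y /S nextE /next -/(X k) -/(Y k) -/(S k).
  case: asboolP => [//|n1]; case: asboolP => [//|n2]; case: asboolP => [//|n3].
  by case.
exists px, py; split; [exact: hx 0%N|exact: hy 0%N|move=> e e0].
have [k hk] := exists_halfpow_lt s00 e0.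
by exists (X k), (Y k), (S k); split; rewrite ?SE// -?SE.
Qed.

(* A monotone function whose increment over an interval of length [s] around
   [0] is at least [sqrt s]; the product measure it defines dominates the side
   length of the squares containing the exceptional point. *)
Definition sqrt_odd (t : R) := Num.sqrt t - Num.sqrt (- t).

Lemma sqrt_odd_le x y : x <= y -> sqrt_odd x <= sqrt_odd y.
Proof. by move=> xy; rewrite lerB// ler_wsqrtr// lerN2. Qed.

(** The increment is [Num.sqrt (x + s) + Num.sqrt (- x)], whose square is at least
    [(x + s) + (- x) = s]. *)
Lemma sqrt_odd_incr x s : x <= 0 -> 0 <= x + s -> 0 <= s ->
  Num.sqrt s <= sqrt_odd (x + s) - sqrt_odd x.
Proof.
move=> x0 xs0 s0; rewrite /sqrt_odd (ler0_sqrtr x0) (@ler0_sqrtr _ (- (x + s))); last lra.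
have Nx0 : 0 <= - x by lra.
have := sqr_sqrtr xs0; have := sqr_sqrtr Nx0; have := sqr_sqrtr s0.
have := sqrtr_ge0 (x + s); have := sqrtr_ge0 (- x); have := sqrtr_ge0 s.
set u := Num.sqrt _; set v := Num.sqrt _; set w := Num.sqrt _ => u0 v0 w0 e1 e2 e3.
rewrite subr0 sub0r opprK -(@ler_sqr R) ?nnegrE ?addr_ge0//.
nra.
Qed.

(* The point [0], where [f] is only assumed continuous, is where the difference
   quotient of Cauchy's formula is singular. *)
Lemma goursat f : relcont (rect (-1) 1 (-1) 1) f ->
  (forall z, rect (-1) 1 (-1) 1 z -> z != 0 -> cdiff f z) ->
  bint f (-1) 1 (-1) 1 = 0.
Proof.
move=> cf df; apply: (@eq0_normc R); apply/eqP; apply: contraT => I0.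
have I_gt0 : 0 < normc (bint f (-1) 1 (-1) 1) by rewrite lt0r I0 normc_ge0.
(* An additive function of squares: the area, which suffices at points of differentiability, plus
   the product measure of [sqrt_odd], which is at least [s] on squares of side [s] containing [0].
   Additivity lets badness pass to a quarter. *)
pose nu x y s := s ^+ 2 +
  (sqrt_odd (x + s) - sqrt_odd x) * (sqrt_odd (y + s) - sqrt_odd y).
have [eps eps0 epsI] : exists2 eps, 0 < eps &
    eps * nu (-1) (-1) 2 < normc (bint f (-1) 1 (-1) 1).
  exists (normc (bint f (-1) 1 (-1) 1) / (`|nu (-1) (-1) 2| + 1)).
    by rewrite divr_gt0// ltr_pwDr.
  rewrite mulrAC ltr_pdivrMr ?ltr_pwDr// ltr_pM2l//.
  by rewrite (le_lt_trans (ler_norm _))// ltrDl.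
pose bad x y s := eps * nu x y s < normc (bint f x (x + s) y (y + s)).
have sub x y s : 0 < s -> -1 <= x -> x + s <= -1 + 2 -> -1 <= y -> y + s <= -1 + 2 ->
    rect x (x + s) y (y + s) `<=` rect (-1) 1 (-1) 1.
  by move=> ? ? ? ? ? z /= [/andP[? ?] /andP[? ?]]; split; apply/andP; split; lra.
have [|||px [py [pxi pyi hp]]] := @square_bisection bad (-1) (-1) 2.
- by [].
- by rewrite /bad; have -> : -1 + 2 = 1 :> R by lra.
- move=> x y s s0 x1 x2 y1 y2; rewrite /bad => hbad.
  have cf' : relcont (rect x (x + (s + s)) y (y + (s + s))) f.
    by apply: relcontW cf; apply: sub => //; lra.
  move: hbad; rewrite (@bint_splitx _ _ (x + s)) //; [|lra..].
  have ym : y <= y + s <= y + (s + s) by lra.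
  rewrite (bint_splity ym); [|lra|]; last first.
    by apply: relcontW cf' => z [/andP[? ?] /andP[? ?]]; split; apply/andP; split; lra.
  rewrite (bint_splity ym); [|lra|]; last first.
    by apply: relcontW cf' => z [/andP[? ?] /andP[? ?]]; split; apply/andP; split; lra.
  move=> hbad.
  set b1 := bint _ _ _ _ _ in hbad; set b2 := bint _ _ _ _ _ in hbad.
  set b3 := bint _ _ _ _ _ in hbad; set b4 := bint _ _ _ _ _ in hbad.
  case: (ltP (eps * nu x y s) (normc b1)) => [?|n1]; first exact: Or41.
  case: (ltP (eps * nu (x + s) y s) (normc b3)) => [?|n3].
    by apply: Or42; rewrite -addrA.
  case: (ltP (eps * nu x (y + s) s) (normc b2)) => [?|n2].
    by apply: Or43; rewrite -(addrA y).
  case: (ltP (eps * nu (x + s) (y + s) s) (normc b4)) => [?|n4].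
    by apply: Or44; rewrite -!addrA.
  have tri : normc (b1 + b2 + (b3 + b4)) <= normc b1 + normc b2 + (normc b3 + normc b4).
    by apply: (le_trans (normcD _ _)); apply: lerD; exact: normcD.
  have nuS : eps * nu x y (s + s) = eps * nu x y s + eps * nu x (y + s) s +
      (eps * nu (x + s) y s + eps * nu (x + s) (y + s) s).
    by rewrite /nu -!(addrA _ s s); ring.
  by have := lt_le_trans hbad tri; rewrite nuS ltNge !lerD.
pose p := px +i* py; have Tp : rect (-1) 1 (-1) 1 p.
  by move: pxi pyi; have -> : -1 + 2 = 1 :> R by lra.
have dist x y s z : x <= px <= x + s -> y <= py <= y + s ->
    rect x (x + s) y (y + s) z -> normc (z - p) <= 2 * s.
  move=> /andP[? ?] /andP[? ?] [/andP[? ?] /andP[? ?]].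
  apply: (le_trans (normc_le_ReIm _)); rewrite ReD ImD ReN ImN /=.
  have : `|Re z - px| <= s by rewrite ler_norml; lra.
  have : `|Im z - py| <= s by rewrite ler_norml; lra.
  by lra.
have nu_ge x y s : 0 < s -> s ^+ 2 <= nu x y s.
  move=> s0; rewrite lerDl mulr_ge0// subr_ge0 sqrt_odd_le// lerDl ltW//.
(* Affine functions have zero boundary integral. *)
have comp al be x y s e : 0 < s -> -1 <= x -> x + s <= -1 + 2 -> -1 <= y ->
    y + s <= -1 + 2 -> (forall z, rect x (x + s) y (y + s) z ->
      normc (f z - (al + be * z)) <= e) ->
    normc (bint f x (x + s) y (y + s)) <= 8 * e * s.
  move=> s0 x1 x2 y1 y2 he.
  have xs : x <= x + s by lra.
  have ys : y <= y + s by lra.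
  have cf' := relcontW (sub _ _ _ s0 x1 x2 y1 y2) cf.
  have ca := @relcont_affine (rect x (x + s) y (y + s)) al be.
  have := bintB xs ys cf' ca; rewrite bint_affine// subr0 => <-.
  apply: (le_trans (bint_le xs ys (relcontB cf' ca) he)).
  by rewrite !(addrC _ s) !addrK; lra.
(* At the exceptional point [f] is compared with the constant [f p]: an error [eps / 8] bounds the
   integral by [eps * s], at most [eps * nu x y s]. *)
have [p0|p0] := eqVneq p 0.
  have e80 : 0 < eps / 8 by rewrite divr_gt0.
  have [d d0 hd] := cf p Tp _ e80; have d20 : 0 < d / 2 by rewrite divr_gt0.
  have [x [y [s [s0 sd hbad [x1 x2 y1 y2] [xp yp]]]]] := hp _ d20.
  have h z : rect x (x + s) y (y + s) z ->
      normc (f z - (f p + 0 * z)) <= eps / 8.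
    move=> hz; rewrite mul0r addr0; apply/ltW/hd; first exact: sub hz.
    by apply: (le_lt_trans (dist _ _ _ _ xp yp hz)); lra.
  have := comp _ _ x y s _ s0 x1 x2 y1 y2 h; rewrite leNgt => /negP; case.
  apply: le_lt_trans hbad.
  move: p0 xp yp; rewrite /p => -[-> ->] /andP[? ?] /andP[? ?].
  have h1 : Num.sqrt s <= sqrt_odd (x + s) - sqrt_odd x.
    by apply: sqrt_odd_incr => //; exact: ltW.
  have h2 : Num.sqrt s <= sqrt_odd (y + s) - sqrt_odd y.
    by apply: sqrt_odd_incr => //; exact: ltW.
  have := ler_pM (sqrtr_ge0 s) (sqrtr_ge0 s) h1 h2.
  rewrite -expr2 sqr_sqrtr; last exact: ltW.
  rewrite [8 * _]mulrC divfK// ler_pM2l// /nu => sP.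
  by rewrite (le_trans sP)// lerDr sqr_ge0.
(* Elsewhere the tangent function is used: the error [eps / 16 * (2 * s)] bounds the integral by
   [eps * s ^+ 2]. *)
have [l hl] := df p Tp p0; have e160 : 0 < eps / 16 by rewrite divr_gt0.
have [d d0 hd] := hl _ e160; have d20 : 0 < d / 2 by rewrite divr_gt0.
have [x [y [s [s0 sd hbad [x1 x2 y1 y2] [xp yp]]]]] := hp _ d20.
have h z : rect x (x + s) y (y + s) z ->
    normc (f z - (f p - l * p + l * z)) <= eps / 16 * (2 * s).
  move=> hz; have hz2 := dist _ _ _ _ xp yp hz.
  rewrite [_ - _](_ : _ = f z - f p - l * (z - p)); last by ring.
  apply: (le_trans (hd _ _)); first by lra.
  by rewrite ler_pM2l.
have := comp _ _ x y s _ s0 x1 x2 y1 y2 h; rewrite leNgt => /negP; case.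
apply: le_lt_trans hbad.
rewrite [X in X <= _](_ : _ = eps * s ^+ 2); last by field.
by rewrite ler_pM2l// nu_ge.
Qed.

End Goursat.

(** * Differentiability of scalar functions, and its form with real moduli *)

Section FieldDifferentiability.
Variable K : numFieldType.

Definition fdiff (f : K -> K) (z : K) := differentiable f z.

(** The division-free inequality also covers [w = z], where the difference quotient says nothing. *)
Lemma fdiffP (f : K -> K) z : fdiff f z <-> exists l, forall e, 0 < e ->
  exists2 d, 0 < d & forall w, `|w - z| < d ->
    `|f w - f z - l * (w - z)| <= e * `|w - z|.
Proof.
rewrite /fdiff -derivable1_diffP; split.
  move=> /cvg_ex[l /cvgrPdist_le hl]; exists l => e /hl.
  rewrite near_withinE near_simpl => /nbhs_ballP[d /= d0 hd].
  exists d => // w wz; have [->|wz0] := eqVneq w z.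
    by rewrite !subrr mulr0 subr0 normr0 mulr0.
  have wz1 : w - z != 0 by rewrite subr_eq0.
  have := hd (w - z); rewrite /ball/= sub0r normrN => /(_ wz wz1).
  rewrite /GRing.scale/= mulr1 subrK => h.
  rewrite -[f w - f z](mulVKf wz1) mulrC -mulrBl.
  by rewrite normrM ler_wpM2r// distrC (le_trans _ h)// mulrC.
move=> [l hl]; apply/cvg_ex; exists l; apply/cvgrPdist_le => e e0.
have [d d0 hd] := hl e e0; rewrite near_withinE near_simpl.
apply/nbhs_ballP; exists d => //= h; rewrite /ball/= sub0r normrN => hd1 h0.
have := hd (h + z); rewrite addrK => /(_ hd1).
rewrite /GRing.scale/= mulr1 -ler_pdivrMr ?normr_gt0// -normf_div.
by rewrite mulrBl mulfK// distrC mulrC.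
Qed.

Lemma fdiff_cst (c z : K) : fdiff (fun=> c) z.
Proof. exact: differentiable_cst. Qed.

Lemma fdiff_id (z : K) : fdiff id z.
Proof. exact: ex_diff. Qed.

Lemma fdiffB (f g : K -> K) z : fdiff f z -> fdiff g z ->
  fdiff (fun w => f w - g w) z.
Proof. exact: differentiableB. Qed.

Lemma fdiffD (f g : K -> K) z : fdiff f z -> fdiff g z ->
  fdiff (fun w => f w + g w) z.
Proof. exact: differentiableD. Qed.

Lemma fdiffM (f g : K -> K) z : fdiff f z -> fdiff g z ->
  fdiff (fun w => f w * g w) z.
Proof. exact: differentiableM. Qed.

Lemma fdiffV (f : K -> K) z : fdiff f z -> f z != 0 ->
  fdiff (fun w => (f w)^-1) z.
Proof. exact: differentiableV. Qed.

Lemma fdiff_comp (f g : K -> K) z : fdiff f z -> fdiff g (f z) ->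
  fdiff (fun w => g (f w)) z.
Proof. exact: differentiable_comp. Qed.

End FieldDifferentiability.

Section ComplexDifferentiability.
Variable R : realType.
Implicit Types f g : R[i] -> R[i].

(** Positive elements of [R[i]] are real, so complex tolerances and radii can be traded for real
    ones. *)
Lemma posc_real (e : R[i]) : 0 < e -> exists2 r : R, 0 < r & e = r%:C.
Proof.
move=> e0; exists (Re e); first by move: e0; rewrite ltcE /= => /andP[].
by rewrite RRe_real// gtr0_real.
Qed.

Lemma cdiffP f z : cdiff f z <-> fdiff f z.
Proof.
rewrite fdiffP; split => -[l hl]; exists l => e e0.
  have [r r0 ->] := posc_real e0; have [d d0 hd] := hl _ r0.
  exists d%:C; first by rewrite ltcR.
  by move=> w; rewrite !normcE ltcR => /hd; rewrite -rmorphM lecR.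
have [|d d0 hd] := hl e%:C; first by rewrite ltcR.
have [r r0 dr] := posc_real d0; exists r => // w wz.
have := hd w; rewrite dr !normcE ltcR => /(_ wz).
by rewrite -rmorphM lecR.
Qed.

Lemma cdiff_continuous f z : cdiff f z -> forall e, 0 < e ->
  exists2 d, 0 < d & forall w, normc (w - z) < d -> normc (f w - f z) < e.
Proof.
move=> [l hl] e e0; have [d d0 hd] := hl 1 ltr01.
have c0 : 0 < 1 + normc l + 1 by have := normc_ge0 l; lra.
exists (Num.min d (e / (1 + normc l + 1))); first by rewrite lt_min d0 divr_gt0.
move=> w; rewrite lt_min ltr_pdivlMr// => /andP[/hd wd we].
rewrite -[f w - f z](subrK (l * (w - z))).
apply: (le_lt_trans (normcD _ _)); rewrite normcM.
by have := normc_ge0 (w - z); nra.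
Qed.

Lemma cdiff_local f g z (d : R) : 0 < d ->
  (forall w, normc (w - z) < d -> f w = g w) -> cdiff f z -> cdiff g z.
Proof.
move=> d0 fg [l hl]; exists l => e /hl[d' d'0 h].
exists (Num.min d d'); first by rewrite lt_min d0.
move=> w; rewrite lt_min => /andP[wd /h]; rewrite !fg//.
by rewrite subrr normc0.
Qed.

End ComplexDifferentiability.

(** * The identity theorem off finitely many points *)

Section Uniqueness.
Variable R : realType.
Implicit Types f g h : R[i] -> R[i].
Notation mu := (@lebesgue_measure R).

Definition bsquare : set R[i] := rect (-1) 1 (-1) 1.

Lemma Rint_ge (f : R -> R) (a b M : R) : a <= b ->
  {within `[a, b], continuous f} -> (forall t, a <= t <= b -> M <= f t) ->
  M * (b - a) <= \int[mu]_(t in `[a, b]) f t.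
Proof.
move=> ab cf fM; rewrite -(Rint_cst M ab); apply: le_Rintegral => //.
- by apply: (@within_integrable _ (fun=> M)) => x; exact: cst_continuous.
- exact: within_integrable.
Qed.

Lemma Rint_leM (f : R -> R) (a b M : R) : a <= b ->
  {within `[a, b], continuous f} -> (forall t, a <= t <= b -> f t <= M) ->
  \int[mu]_(t in `[a, b]) f t <= M * (b - a).
Proof.
move=> ab cf fM; rewrite -(Rint_cst M ab); apply: le_Rintegral => //.
- exact: within_integrable.
- by apply: (@within_integrable _ (fun=> M)) => x; exact: cst_continuous.
Qed.

Lemma sqr_itv (t : R) : -1 <= t <= 1 -> t ^+ 2 <= 1.
Proof. by move=> /andP[? ?]; nra. Qed.

(* The exact value is [2 * pi * i]. *)
Lemma bint_inv_neq0 f : relcont bsquare f ->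
  (forall z, bsquare z -> [\/ Re z = -1, Re z = 1, Im z = -1 | Im z = 1] ->
    f z = z^-1) -> bint f (-1) 1 (-1) 1 != 0.
Proof.
move=> cf fV; apply/eqP => /(congr1 Im); rewrite ImD ImM /= mul0r mul1r add0r.
have N11 : -1 <= 1 :> R by lra.
have [_ c1] : segcont (fun t => f (t +i* (-1))) (-1) 1.
  by apply: (segcont_hor _ cf); lra.
have [_ c2] : segcont (fun t => f (t +i* 1)) (-1) 1.
  by apply: (segcont_hor _ cf); lra.
have [c3 _] : segcont (fun t => f (1 +i* t)) (-1) 1.
  by apply: (segcont_ver _ cf); lra.
have [c4 _] : segcont (fun t => f (-1 +i* t)) (-1) 1.
  by apply: (segcont_ver _ cf); lra.
(* On each side the relevant component of [z^-1] has modulus [(1 + t ^+ 2)^-1], at least [2^-1], and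
   a sign that makes its contribution positive; the imaginary part of the contour integral is
   therefore at least [4]. *)
have i1 := Rint_ge (M := 2^-1) N11 c1; have i2 := Rint_leM (M := - 2^-1) N11 c2.
have i3 := Rint_ge (M := 2^-1) N11 c3; have i4 := Rint_leM (M := - 2^-1) N11 c4.
have key (t : R) : -1 <= t <= 1 -> 2^-1 <= (1 + t ^+ 2)^-1.
  move=> /sqr_itv t1; rewrite lef_pV2 ?posrE//; first by lra.
  by rewrite ltr_pwDl// sqr_ge0.
have j1 : forall t, -1 <= t <= 1 -> 2^-1 <= Im (f (t +i* (-1))).
  move=> t t1; rewrite fV; [|by split => //=; rewrite lexx N11|exact: Or43].
  by rewrite /= sqrrN expr1n mulNr opprK mul1r addrC key.
have j2 : forall t, -1 <= t <= 1 -> Im (f (t +i* 1)) <= - 2^-1.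
  move=> t t1; rewrite fV; [|by split => //=; rewrite lexx N11|exact: Or44].
  by rewrite /= expr1n mul1r lerN2 addrC key.
have j3 : forall t, -1 <= t <= 1 -> 2^-1 <= Re (f (1 +i* t)).
  move=> t t1; rewrite fV; [|by split => //=; rewrite lexx N11|exact: Or42].
  by rewrite /= expr1n mul1r key.
have j4 : forall t, -1 <= t <= 1 -> Re (f (-1 +i* t)) <= - 2^-1.
  move=> t t1; rewrite fV; [|by split => //=; rewrite lexx N11|exact: Or41].
  by rewrite /= sqrrN expr1n mulN1r lerN2 key.
have := i1 j1; have := i2 j2; have := i3 j3; have := i4 j4.
by move=> ? ? ? ? ?; lra.
Qed.

(** Cauchy's formula by contradiction: if [g 0 != 0], the difference quotient at [0] of
    [k = - g / g 0] has zero contour integral by [goursat], yet equals [z^-1] on the boundary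
    because [k] is [0] there and [k 0 = -1]. *)
Lemma square_boundary_eq0 g : (forall z, bsquare z -> cdiff g z) ->
  (forall z, bsquare z -> [\/ Re z = -1, Re z = 1, Im z = -1 | Im z = 1] -> g z = 0) ->
  g 0 = 0.
Proof.
move=> dg g0; apply/eqP; apply: contraT => g00.
have T0 : bsquare 0 by split => /=; lra.
pose k z := - g z / g 0.
have dk z : bsquare z -> cdiff k z.
  move=> /dg/cdiffP dgz; apply/cdiffP; rewrite /k.
  have -> : (fun z => - g z / g 0) = (fun z => g z * (- (g 0)^-1)).
    by apply/funext => w; rewrite mulNr mulrN.
  by apply: fdiffM => //; exact: fdiff_cst.
have k0 : k 0 = -1 by rewrite /k mulNr divff.
have [l hl] := dk 0 T0.
(* The derivative [l] extends the quotient continuously to [0], where [goursat] asks for no more. *)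
pose q z := if z == 0 then l else (k z - k 0) / z.
have dq z : bsquare z -> z != 0 -> cdiff q z.
  move=> Tz z0; have nz0 : 0 < normc z.
    by rewrite lt0r normc_ge0 andbT; apply: contra z0 => /eqP/eq0_normc ->.
  apply: (cdiff_local nz0 (f := fun z => (k z - k 0) / z)).
    move=> w wz; rewrite /q; case: eqVneq wz => // ->.
    by rewrite sub0r normc_opp ltxx.
  apply/cdiffP/fdiffM; first by apply: fdiffB; [exact/cdiffP/dk|exact: fdiff_cst].
  by apply: fdiffV => //; exact: fdiff_id.
have cq : relcont bsquare q.
  move=> z Tz e e0; have [->|z0] := eqVneq z 0; last first.
    have [d d0 hd] := cdiff_continuous (dq z Tz z0) e0.
    by exists d => // w _; exact: hd.
  have e20 : 0 < e / 2 by rewrite divr_gt0.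
  have [d d0 hd] := hl _ e20; exists d => // w _ wd.
  rewrite {2}/q eqxx /q; case: eqVneq => [|w0]; first by rewrite subrr normc0.
  have nw0 : 0 < normc w.
    by rewrite lt0r normc_ge0 andbT; apply: contra w0 => /eqP/eq0_normc ->.
  have := hd w wd; rewrite subr0 => h; rewrite -(ltr_pM2r nw0) -normcM.
  rewrite mulrBl divfK//; apply: (le_lt_trans h); rewrite ltr_pM2r//.
  by rewrite ltr_pdivrMr// ltr_pMr// ltr1n.
suff /eqP : bint q (-1) 1 (-1) 1 != 0 by case; exact: goursat cq dq.
apply: bint_inv_neq0 => // z Tz bz.
rewrite /q k0; case: eqVneq => [z0|_].
  by move: bz; rewrite z0 => -[] /= /eqP; rewrite eq_sym ?oppr_eq0 oner_eq0.
by rewrite /k g0// oppr0 mul0r sub0r opprK mul1r.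
Qed.

(* The product of the four rotations of [h] vanishes on the whole boundary. *)
Lemma square_side_eq0 h : (forall z, bsquare z -> cdiff h z) ->
  (forall t, -1 <= t <= 1 -> h (t +i* (-1)) = 0) -> h 0 = 0.
Proof.
move=> dh h0.
pose g z := h z * h ('i%C * z) * (h (- z) * h (- ('i%C * z))).
have rotT z : bsquare z -> bsquare ('i%C * z).
  by move=> [/andP[? ?] /andP[? ?]]; split; rewrite ?ReM ?ImM /=; lra.
have negT z : bsquare z -> bsquare (- z).
  by move=> [/andP[? ?] /andP[? ?]]; split; rewrite ?ReN ?ImN /=; lra.
have dmul (c z : R[i]) : fdiff (fun w => c * w) z.
  by apply: fdiffM; [exact: fdiff_cst|exact: fdiff_id].
have dN (f : R[i] -> R[i]) z : fdiff f z -> fdiff (fun w => - f w) z.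
  move=> df; have -> : (fun w => - f w) = (fun w => 0 - f w).
    by apply/funext => w; rewrite sub0r.
  by apply: fdiffB => //; exact: fdiff_cst.
have := @square_boundary_eq0 g; rewrite /g !mulr0 oppr0 => H.
suff /eqP : h 0 * h 0 * (h 0 * h 0) = 0 by rewrite !mulf_eq0 !orbb => /eqP.
apply: H => [z Tz|z [/andP[x1 x2] /andP[y1 y2]] bz].
  apply/cdiffP; apply: fdiffM; apply: fdiffM.
  - exact/cdiffP/dh.
  - by apply: fdiff_comp => //; exact/cdiffP/dh/rotT.
  - by apply: fdiff_comp; [apply/dN/fdiff_id|apply/cdiffP/dh/negT].
  - by apply: fdiff_comp; [apply/dN|apply/cdiffP/dh/negT/rotT].
have side w : Im w = -1 -> -1 <= Re w <= 1 -> h w = 0.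
  by case: w => x y /= -> xx; exact: h0.
case: bz => e.
- by rewrite (side ('i%C * z)) ?mulr0 ?mul0r// ?ReM ?ImM /= ?e; lra.
- by rewrite (side (- ('i%C * z))) ?mulr0 ?mul0r// ?ReN ?ImN ?ReM ?ImM /= ?e; lra.
- by rewrite (side z) ?mul0r// ; lra.
- by rewrite (side (- z)) ?mul0r ?mulr0// ?ReN ?ImN /= ?e; lra.
Qed.

Lemma normc_bsquare z : bsquare z -> normc z <= 3 / 2.
Proof.
move=> [/andP[? ?] /andP[? ?]]; apply: normc_le_sqr; first by lra.
by nra.
Qed.

(** Transport of [square_side_eq0] by [w |-> p + v * w]: [p] is the center, and [v] gives the half
    side and the direction. The constant [3 / 2] exceeds the square root of [2]. *)
Lemma affine_square_eq0 h (p v : R[i]) :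
  (forall w, normc (w - p) <= 3 / 2 * normc v -> cdiff h w) ->
  (forall t, -1 <= t <= 1 -> h (p + v * (t +i* (-1))) = 0) -> h p = 0.
Proof.
move=> dh h0; have := @square_side_eq0 (fun w => h (p + v * w)).
rewrite mulr0 addr0; apply => // z Tz; apply/cdiffP.
apply: (fdiff_comp (f := fun w => p + v * w)).
  by apply: fdiffD; [exact: fdiff_cst|
    apply: fdiffM; [exact: fdiff_cst|exact: fdiff_id]].
apply/cdiffP/dh; rewrite addrC addKr normcM mulrC.
by apply: ler_wpM2r; rewrite ?normc_ge0// normc_bsquare.
Qed.

(** The square centered at [p] is turned so that the midpoint of its side is that of [p] and [q].
    The side stays within [3 / 4 * normc (p - q)] of [q], less than [r] since [3 / 4 * (6 / 5) < 1],
    and the square stays within [3 * r]. *)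
Lemma disc_enlarge h q (r : R) : 0 < r ->
  (forall w, normc (w - q) < 3 * r -> cdiff h w) ->
  (forall w, normc (w - q) < r -> h w = 0) ->
  forall w, normc (w - q) < 6 / 5 * r -> h w = 0.
Proof.
move=> r0 dh h0 p pq; set v := (p - q) * (0 +i* (- 2^-1)).
have nv : normc v = normc (p - q) / 2.
  by rewrite normcM normc_Complex expr0n add0r sqrrN sqrtr_sqr ger0_norm.
apply: (@affine_square_eq0 h p v).
  move=> w; rewrite nv => wp; apply: dh.
  have -> : w - q = (w - p) + (p - q) by ring.
  by apply: (le_lt_trans (normcD _ _)); lra.
move=> t t1; apply: h0.
have -> : p + v * (t +i* (-1)) - q = (p - q) * ((1 / 2) +i* (- t / 2)).
  rewrite /v addrAC; case: (p - q) => x y.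
  by apply: complex_ext; rewrite ?ReD ?ImD !(ReM, ImM) /= ?ReM ?ImM /=; field.
rewrite normcM.
have : normc ((1 / 2) +i* (- t / 2)) <= 3 / 4.
  by apply: normc_le_sqr; [lra|move: t1 => /andP[? ?] /=; nra].
by have := normc_ge0 (p - q); have := normc_ge0 ((1 / 2) +i* (- t / 2)); nra.
Qed.

(** Taking the real number [Im p], with its sign, as [v] puts one side of the square centered at [p]
    on the real axis. *)
Lemma disc_real_axis h (x r : R) : 0 < r ->
  (forall w, normc (w - x%:C) < r -> cdiff h w) ->
  (forall t : R, `|t - x| < r -> h t%:C = 0) ->
  forall w, normc (w - x%:C) < r / 4 -> h w = 0.
Proof.
move=> r0 dh h0 p pq; have := Im_le_normc (p - x%:C); have := Re_le_normc (p - x%:C).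
rewrite ImD ReD ImN ReN /= subr0 => hRe hIm.
apply: (@affine_square_eq0 h p (Im p)%:C); rewrite ?normc_real.
  move=> w wp; apply: dh; rewrite -(subrK p w) -addrA.
  by apply: (le_lt_trans (normcD _ _)); lra.
move=> t t1; have -> : p + (Im p)%:C * (t +i* (-1)) = (Re p + Im p * t)%:C.
  by apply: complex_ext; rewrite ?ReD ?ImD ?ReM ?ImM /=; ring.
apply: h0; rewrite addrAC; apply: (le_lt_trans (ler_normD _ _)); rewrite normrM.
have : `|t| <= 1 by rewrite ler_norml.
by have := normr_ge0 t; have := normr_ge0 (Im p); nra.
Qed.

(** With [r = rho / 3], the segment is cut into [N] steps shorter than [r / 5], the gain in radius
    of [disc_enlarge]; discs of radius [r] are then carried from [a] to [a + v]. *)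
Lemma disc_chain h (a v : R[i]) (rho : R) : 0 < rho ->
  (forall t : R, 0 <= t <= 1 -> forall w,
    normc (w - (a + t%:C * v)) < rho -> cdiff h w) ->
  (forall w, normc (w - a) < rho / 3 -> h w = 0) -> h (a + v) = 0.
Proof.
move=> rho0 dh h0; pose r := rho / 3; have r0 : 0 < r by rewrite divr_gt0.
have vr0 : 0 <= 5 * normc v / r by rewrite divr_ge0 ?mulr_ge0 ?normc_ge0// ltW.
set N := Num.bound (5 * normc v / r).
have N0 : 0 < N%:R :> R by exact: le_lt_trans vr0 (archi_boundP vr0).
have vN : normc v / N%:R < r / 5.
  have := archi_boundP vr0; rewrite -/N ltr_pdivrMr// => h1.
  by rewrite ltr_pdivrMr//; lra.
have disc k : (k <= N)%N -> forall w,
    normc (w - (a + (k%:R / N%:R)%:C * v)) < r -> h w = 0.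
  elim: k => [_ w|k ih kN w wk]; first by rewrite mul0r rmorph0 mul0r addr0 => /h0.
  apply: (disc_enlarge r0 _ (ih (ltnW kN))).
    move=> z zk; apply: (dh (k%:R / N%:R)).
      by rewrite divr_ge0 ?ler0n//= ler_pdivrMr// mul1r ler_nat ltnW.
    by apply: (lt_le_trans zk); rewrite /r; lra.
  have -> : w - (a + (k%:R / N%:R)%:C * v) =
      w - (a + (k.+1%:R / N%:R)%:C * v) + (N%:R^-1)%:C * v.
    by rewrite -natr1 mulrDl mul1r rmorphD/=; ring.
  apply: (le_lt_trans (normcD _ _)); rewrite normcM normc_real.
  rewrite ger0_norm ?invr_ge0 ?ler0n//.
  by move: vN; rewrite mulrC => ?; lra.
apply: (disc N) => //; rewrite divff ?gt_eqF// rmorph1 mul1r subrr normc0//.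
Qed.

End Uniqueness.

Section IdentityTheorem.
Variable R : realType.

Lemma exists_notin_seq (s : seq R) : exists x, x \notin s.
Proof.
exists (1 + \sum_(y <- s) `|y|); apply/negP => xs.
have : 1 + \sum_(y <- s) `|y| <= \sum_(y <- s) `|y|.
  rewrite {2}(perm_big _ (perm_to_rem xs)) big_cons/= ger0_norm; last first.
    by rewrite addr_ge0// sumr_ge0.
  by rewrite lerDl sumr_ge0.
by rewrite gerDr ler10.
Qed.

Lemma exists_pos_lower_bound (s : seq R) : (forall x, x \in s -> 0 < x) ->
  exists2 r, 0 < r & forall x, x \in s -> r <= x.
Proof.
elim: s => [_|a s ih h]; first by exists 1.
have [x xs|r r0 hr] := ih; first by apply: h; rewrite inE xs orbT.
exists (Num.min r a); first by rewrite lt_min r0 h// mem_head.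
by move=> x; rewrite inE => /predU1P[->|/hr]; rewrite ge_min ?lexx ?orbT// => ->.
Qed.

Lemma identity_off_roots (d : {poly R[i]}) (h : R[i] -> R[i]) :
  d.['i%C] != 0 -> (forall z, d.[z] != 0 -> cdiff h z) ->
  (forall t : R, d.[t%:C] != 0 -> h t%:C = 0) -> h 'i%C = 0.
Proof.
move=> di dh h0; have [rs drs] := closed_field_poly_normal d.
have d0 : d != 0 by apply: contraNneq di => ->; rewrite horner0.
have drE z : (d.[z] != 0) = (z \notin rs).
  rewrite -root_prod_XsubC {1}drs hornerZ mulf_eq0 lead_coef_eq0 (negPf d0).
  by rewrite /root.
have irs : 'i%C \notin rs by rewrite -drE.
(* A root [s] lies on the line through [x0] and ['i] exactly when [(1 - Im s) * x0 = Re s], so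
   finitely many [x0] are excluded. If [Im s = 1] the listed quotient is [0] by convention; such a
   root could be on the line only if it were ['i]. *)
have [x0 hx0] := exists_notin_seq [seq Re s / (1 - Im s) | s <- rs].
have nz s : s \in rs -> (1 - Im s) * x0 - Re s != 0.
  move=> srs; rewrite subr_eq0; have [s1|s1] := eqVneq (1 - Im s) 0.
    rewrite s1 mul0r eq_sym; apply: contraNneq irs => s0.
    suff -> : 'i%C = s by [].
    by apply: complex_ext => /=; [rewrite s0|apply/eqP; rewrite -subr_eq0 s1].
  apply: contraNneq hx0 => e; apply/mapP; exists s => //.
  by rewrite -e [X in X / _]mulrC mulfK.
have x01 : 0 < 1 + `|x0| by rewrite ltr_pwDl.
(* A lower bound for the distance from [s] to the line: the numerator is an affine form vanishing on
   it, with Lipschitz constant at most [1 + |x0|]. *)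
pose gap s := `|(1 - Im s) * x0 - Re s| / (1 + `|x0|).
have [_ /mapP[s srs ->]|rho rho0 hrho] := @exists_pos_lower_bound (map gap rs).
  by rewrite divr_gt0// normr_gt0 nz.
have away (t : R) w : normc (w - (x0%:C + t%:C * ('i%C - x0%:C))) < rho -> cdiff h w.
  move=> wt; apply: dh; rewrite drE; apply: contraTN wt => wrs.
  rewrite -leNgt; apply: (le_trans (hrho _ (map_f gap wrs))).
  rewrite /gap ler_pdivrMr//; set D := w - _.
  have -> : (1 - Im w) * x0 - Re w = - Re D - x0 * Im D.
    by rewrite /D; case: (w) => p q /=; ring.
  apply: (le_trans (ler_normB _ _)); rewrite normrN normrM.
  have := Re_le_normc D; have := Im_le_normc D; have := normr_ge0 x0.
  by nra.
(* A third of [3 / 4 * rho] is [rho / 4], the radius that [disc_real_axis] provides. *)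
have := @disc_chain R h x0%:C ('i%C - x0%:C) (3 / 4 * rho).
rewrite [x0%:C + (_ - _)]addrC subrK; apply.
- by rewrite mulr_gt0.
- by move=> t _ w wt; apply: (away t); apply: (lt_le_trans wt); lra.
have away0 w : normc (w - x0%:C) < rho -> cdiff h w.
  by move=> hw; apply: (away 0); rewrite rmorph0 mul0r addr0.
move=> w wr; apply: (disc_real_axis rho0 away0); last by lra.
move=> t tx; apply: h0; rewrite drE; apply/negP => /[dup] trs /(map_f gap)/hrho.
rewrite /gap /= subr0 mul1r ler_pdivlMr// distrC => ?.
by have := normr_ge0 x0; nra.
Qed.

End IdentityTheorem.

(** * Rational curves in the orbit *)

Section OrbitCurves.
Variables (C : numClosedFieldType) (n m : nat).
Implicit Types (Q A B : 'M[C]_(n, m)) (W D E : 'M[C]_(m, n)).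

(* The element of [Orb] with image [Q] and kernel [ker W]; a junk value when
   [W *m Q] is not invertible. *)
Definition orbmx Q W : 'M[C]_n :=
  ('i / \det (W *m Q)) *: (Q *m \adj (W *m Q) *m W).

Lemma orbmxE Q W : \det (W *m Q) != 0 ->
  orbmx Q W = 'i *: (Q *m invmx (W *m Q) *m W).
Proof.
move=> d0; rewrite /orbmx /invmx unitmxE unitfE d0.
by rewrite -scalemxAr -scalemxAl scalerA.
Qed.

Lemma orbmx_Orb Q W : \det (W *m Q) != 0 -> Orb C n m (orbmx Q W).
Proof.
move=> d0; exists Q, (('i / \det (W *m Q)) *: (\adj (W *m Q) *m W)); split.
  by rewrite -scalemxAl -mulmxA mul_adj_mx scale_scalar_mx divfK.
by rewrite -scalemxAr mulmxA.
Qed.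

Lemma orbmx_factor Q W : W *m Q = 'i%:M ->
  \det (W *m Q) != 0 /\ orbmx Q W = Q *m W.
Proof.
move=> WQ; have d0 : \det (W *m Q) != 0.
  by rewrite WQ det_scalar expf_neq0// neq0Ci.
split=> //; rewrite orbmxE// WQ invmx_scalar mul_mx_scalar -scalemxAl.
by rewrite scalerA divff ?neq0Ci// scale1r.
Qed.

Lemma det_adj p (M : 'M[C]_p) : \det (M^t*) = (\det M)^*.
Proof. by rewrite det_map_mx det_tr. Qed.

(** The involution exchanges the two factors and takes their adjoints, so it carries rational curves
    to antiholomorphic ones of the same shape. *)
Lemma orbmx_opp_adj Q W : - (orbmx Q W)^t* = orbmx (W^t*) (Q^t*).
Proof.
have adjE : (\adj (W *m Q))^t* = \adj (Q^t* *m W^t*).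
  by rewrite trmx_adj map_mx_adj -adjmxM.
rewrite /orbmx -adjmxM det_adj adjmxZ !adjmxM adjE -scaleNr !mulmxA.
by rewrite rmorphM/= conjCi fmorphV mulNr opprK.
Qed.

Lemma orbmx_opp_conj Q W : - cmxconj (orbmx Q W) = orbmx (cmxconj Q) (cmxconj W).
Proof.
have adjE : cmxconj (\adj (W *m Q)) = \adj (cmxconj W *m cmxconj Q).
  by rewrite -cmxconjM; exact: map_mx_adj.
have detE : \det (cmxconj W *m cmxconj Q) = (\det (W *m Q))^*.
  by rewrite -cmxconjM; exact: det_map_mx.
rewrite /orbmx detE cmxconjZ !cmxconjM adjE -scaleNr.
by rewrite rmorphM/= conjCi fmorphV mulNr opprK.
Qed.

Lemma orbmx_anticommute (T : 'M[C]_n) (Tm : 'M[C]_m) Q W :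
  \det (W *m Q) != 0 -> Q *m Tm = T *m cmxconj Q -> W *m T = Tm *m cmxconj W ->
  orbmx Q W *m T = - (T *m cmxconj (orbmx Q W)).
Proof.
move=> d0 hQ hW; have d0' : \det (cmxconj W *m cmxconj Q) != 0.
  by rewrite -cmxconjM det_map_mx conjC_eq0.
rewrite -mulmxN orbmx_opp_conj !orbmxE// -scalemxAl -scalemxAr; congr (_ *: _).
have u : W *m Q \in unitmx by rewrite unitmxE unitfE.
have u' : cmxconj W *m cmxconj Q \in unitmx by rewrite unitmxE unitfE.
have hinv : invmx (W *m Q) *m Tm = Tm *m invmx (cmxconj W *m cmxconj Q).
  apply: (can_inj (mulKmx u)); rewrite mulKVmx// !mulmxA.
  apply: (can_inj (mulmxK u')); rewrite mulmxKV//.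
  by rewrite -(mulmxA W) hQ !mulmxA hW.
rewrite -mulmxA hW mulmxA -(mulmxA Q) hinv mulmxA hQ.
by rewrite !mulmxA.
Qed.

(* The real part for the conjugation [X |-> eps *: (T1 *m cmxconj X *m T2)];
   [eps] is [1] for a real structure and [-1] for a quaternionic one. *)
Lemma real_decomposition p q (T1 : 'M[C]_p) (T2 : 'M[C]_q) (eps : C)
    (X : 'M[C]_(p, q)) :
  cmxconj T1 = T1 -> cmxconj T2 = T2 -> eps^* = eps -> eps * eps = 1 ->
  T1 *m T1 = eps%:M -> T2 *m T2 = eps%:M ->
  exists A B : 'M[C]_(p, q), [/\ X = A + 'i *: B, A *m T2 = T1 *m cmxconj A &
    B *m T2 = T1 *m cmxconj B].
Proof.
move=> r1 r2 er e2 h1 h2.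
(* [t] is the conjugate of [X]; the witnesses are half of [X + t] and of [- 'i *: (X - t)]. *)
pose t := eps *: (T1 *m cmxconj X *m T2).
have tX : t *m T2 = T1 *m cmxconj X.
  by rewrite -scalemxAl -mulmxA h2 mul_mx_scalar scalerA e2 scale1r.
have tt : T1 *m cmxconj t = X *m T2.
  rewrite cmxconjZ er !cmxconjM r1 r2 cmxconjK -scalemxAr !mulmxA h1.
  by rewrite mul_scalar_mx -scalemxAl scalerA e2 scale1r.
have c2 : (2^-1 : C)^* = 2^-1 by apply: conj_Creal; rewrite realV realn.
exists (2^-1 *: (X + t)), ((- 'i / 2) *: (X - t)); split.
- rewrite scalerA mulrA mulrN -expr2 sqrCi opprK mul1r -scalerDr addrACA subrr addr0.
  by rewrite scalerDr -scalerDl -[2^-1]mul1r -splitr scale1r.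
- by rewrite cmxconjZ c2 cmxconjD -scalemxAl -scalemxAr mulmxDl mulmxDr tX tt addrC.
rewrite cmxconjZ rmorphM/= rmorphN/= conjCi c2 opprK cmxconjD cmxconjN.
rewrite -scalemxAl -scalemxAr mulmxBl mulmxBr tX tt mulNr scaleNr -scalerN.
by rewrite opprB.
Qed.

End OrbitCurves.

(** * Differentiability of polynomials, of matrix curves and along curves *)

Section PolynomialCurves.
Variable K : numFieldType.

Lemma fdiff_horner (p : {poly K}) z : fdiff (fun w => p.[w]) z.
Proof.
elim/poly_ind: p => [|p c ih].
  have -> : (fun w => (0 : {poly K}).[w]) = fun=> 0.
    by apply/funext => w; rewrite horner0.
  exact: fdiff_cst.
have -> : (fun w => (p * 'X + c%:P).[w]) = (fun w => p.[w] * w + c).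
  by apply/funext => w; rewrite hornerMXaddC.
by apply: fdiffD; [apply: fdiffM => //; exact: fdiff_id|exact: fdiff_cst].
Qed.

Definition curve_diff (V : normedModType K) (c : K -> V) (z : K) :=
  differentiable c z.

Lemma curve_diff_pair (V W : normedModType K) (c : K -> V) (d : K -> W) (z : K) :
  curve_diff c z -> curve_diff d z -> curve_diff (fun w => (c w, d w)) z.
Proof. exact: differentiable_pair. Qed.

Lemma curve_diff_mx p q (M : K -> 'M[K]_(p, q)) z :
  (forall i j, fdiff (fun w => M w i j) z) -> curve_diff M z.
Proof.
move=> h; rewrite /curve_diff.
have -> : M = \sum_i \sum_j (fun w => M w i j *: delta_mx i j).
  apply/funext => w; rewrite [LHS]matrix_sum_delta fct_sumE.
  by apply: eq_bigr => i _; rewrite fct_sumE.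
apply: differentiable_sum => i; apply: differentiable_sum => j.
by apply: differentiableZl; exact: h.
Qed.

Lemma near_horner_neq0 (p : {poly K}) z : p.[z] != 0 -> \forall w \near z, p.[w] != 0.
Proof.
move=> pz; have /differentiable_continuous cp : fdiff (fun w => p.[w]) z.
  exact: fdiff_horner.
exact: (cvgr_neq0 _ cp pz).
Qed.

Lemma holomorphic_on_comp (V : normedModType K) (S : set V) (f : V -> K)
    (c : K -> V) (z : K) : holomorphic_on S f -> curve_diff c z ->
  S (c z) -> (\forall w \near z, S (c w)) -> fdiff (fun w => f (c w)) z.
Proof.
move=> fS dc Sz Sc; have [U [g [oU Uz dg fg]]] := fS _ Sz.
have dgc : fdiff (fun w => g (c w)) z by exact: differentiable_comp (dg _ Uz).
have Uc : \forall w \near z, U (c w).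
  by have := differentiable_continuous dc; apply; exact: open_nbhs_nbhs.
have : \forall w \near z, f (c w) = g (c w).
  by near=> w; apply: fg; near: w.
move=> /nbhs_ballP[r /= r0 hr]; move: dgc; rewrite !fdiffP => -[l hl].
exists l => e /hl[d d0 hd].
(* The order of [K] is partial; the minimum of [d] and [r] makes sense because positive elements are
   comparable. *)
have dr := real_comparable (gtr0_real d0) (gtr0_real r0).
exists (Num.min d r); first by rewrite comparable_lt_min// d0.
move=> w; rewrite comparable_lt_min// => /andP[wd wr].
rewrite !hr; first exact: hd.
  exact: ballxx.
by rewrite /ball/= distrC.
Unshelve. all: by end_near. Qed.

End PolynomialCurves.

(** * Reflection of a holomorphic function along a pair of curves *)

Section Reflection.
Variable R : realType.

Lemma conjcE (z : R[i]) : Num.conj z = conjc z.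
Proof. by []. Qed.

Lemma cdiff_conj_conj (k : R[i] -> R[i]) (z : R[i]) :
  cdiff k (conjc z) -> cdiff (fun w => conjc (k (conjc w))) z.
Proof.
move=> [l hl]; exists (conjc l) => e /hl[d d0 hd]; exists d => // w wz.
have ewz : normc (conjc w - conjc z) = normc (w - z).
  by rewrite -rmorphB normc_conj.
rewrite -normc_conj !(rmorphB, rmorphM)/= !conjcK -ewz.
by apply: hd; rewrite ewz.
Qed.

(** The two conjugations make the right-hand side holomorphic in the parameter; it agrees with the
    left one on the real axis, and [identity_off_roots] reaches ['i]. *)
Lemma reflection_principle (V : normedModType R[i]) (S : set V) (f : V -> R[i])
    (c c' : R[i] -> V) (d : {poly R[i]}) :
  holomorphic_on S f -> d.['i] != 0 ->
  (forall z, d.[z] != 0 -> [/\ curve_diff c z, S (c z),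
     curve_diff c' (Num.conj z) & S (c' (Num.conj z))]) ->
  (forall t : R, d.[t%:C] != 0 -> f (c t%:C) = Num.conj (f (c' t%:C))) ->
  f (c 'i) = Num.conj (f (c' (Num.conj 'i))).
Proof.
move=> fS di hc fc; apply/eqP; rewrite -subr_eq0; apply/eqP.
rewrite -complexiE.
apply: (@identity_off_roots R d (fun z => f (c z) - Num.conj (f (c' (Num.conj z))))).
- by rewrite complexiE.
- move=> z dz; have [dc Sc dc' Sc'] := hc z dz.
  have nz := near_horner_neq0 dz.
  apply/cdiffP/fdiffB; apply/cdiffP.
    apply/cdiffP; apply: (holomorphic_on_comp fS dc Sc).
    by apply: filterS nz => w dw; have [] := hc w dw.
  apply: (@cdiff_conj_conj (fun w => f (c' w)) z); apply/cdiffP.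
  apply: (holomorphic_on_comp fS dc' Sc').
  move/nbhs_ballP: nz => [r /= r0 hr]; apply/nbhs_ballP; exists r => // w.
  rewrite /ball/= => wz; rewrite -[w]conjCK.
  have [] := hc (Num.conj w) => //; apply: hr.
  by rewrite /ball/= -norm_conjC rmorphB/= conjCK.
- move=> t dt; have -> : Num.conj t%:C = t%:C :> R[i] by rewrite conjcE conjc_real.
  by rewrite fc// subrr.
Qed.

End Reflection.

(** * Curves in the orbit given by matrix pencils *)

Section Pencils.
Variable C : numClosedFieldType.

Definition pencil p q (A B : 'M[C]_(p, q)) : 'M[{poly C}]_(p, q) :=
  map_mx polyC A + 'X *: map_mx polyC B.

Lemma pencilE p q (A B : 'M[C]_(p, q)) z :
  map_mx (horner_eval z) (pencil A B) = A + z *: B.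
Proof.
apply/matrixP => i j.
by rewrite !mxE /horner_eval hornerD hornerM hornerX !hornerC.
Qed.

Variables (n m : nat).
Implicit Types (A B : 'M[C]_(n, m)) (D E : 'M[C]_(m, n)).

Definition orb_curve A B D E (z : C) : 'M[C]_n :=
  orbmx (A + z *: B) (D + z *: E).

Definition pencil_det A B D E : {poly C} := \det (pencil D E *m pencil A B).

Lemma pencil_detE A B D E z :
  (pencil_det A B D E).[z] = \det ((D + z *: E) *m (A + z *: B)).
Proof.
rewrite -(pencilE A B z) -(pencilE D E z) -map_mxM.
by rewrite det_map_mx.
Qed.

(** The adjugate makes each entry a polynomial divided by [pencil_det]. *)
Lemma orb_curve_diff A B D E z : (pencil_det A B D E).[z] != 0 ->
  curve_diff (orb_curve A B D E) z.
Proof.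
move=> dz; pose N := pencil A B *m \adj (pencil D E *m pencil A B) *m pencil D E.
have NE w i j : orb_curve A B D E w i j = 'i / (pencil_det A B D E).[w] * (N i j).[w].
  rewrite /orb_curve /orbmx mxE -pencil_detE; congr (_ * _).
  rewrite -(pencilE A B w) -(pencilE D E w) -map_mxM -map_mx_adj -!map_mxM.
  by rewrite mxE.
apply: curve_diff_mx => i j; under eq_fun do rewrite NE.
apply: fdiffM; last exact: fdiff_horner.
apply: fdiffM; first exact: fdiff_cst.
by apply: fdiffV => //; exact: fdiff_horner.
Qed.

End Pencils.

Section DualCurve.
Variables (C : numClosedFieldType) (n m : nat).
Variables (A B : 'M[C]_(n, m)) (D E : 'M[C]_(m, n)).

Lemma adjmx_pencil p q (X Y : 'M[C]_(p, q)) z :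
  (X + z *: Y)^t* = X^t* + z^* *: Y^t*.
Proof. by rewrite adjmxD adjmxZ. Qed.

(** The image of the curve under the involution, with the parameter conjugated so that it is
    holomorphic again. *)
Definition dual_curve := orb_curve (D^t*) (E^t*) (A^t*) (B^t*).

Lemma dual_curveE z : dual_curve z^* = - (orb_curve A B D E z)^t*.
Proof. by rewrite /dual_curve /orb_curve orbmx_opp_adj !adjmx_pencil. Qed.

Lemma orb_curveP z : (pencil_det A B D E).[z] != 0 ->
  [/\ curve_diff (orb_curve A B D E) z, Orb C n m (orb_curve A B D E z),
    curve_diff dual_curve z^* & Orb C n m (dual_curve z^*)].
Proof.
move=> dz; have oz : Orb C n m (orb_curve A B D E z).
  by apply: orbmx_Orb; rewrite -pencil_detE.
split=> //; first exact: orb_curve_diff.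
  apply: orb_curve_diff; rewrite pencil_detE -!adjmx_pencil -adjmxM det_adj.
  by rewrite conjC_eq0 -pencil_detE.
by rewrite dual_curveE; exact: Orb_opp_adj.
Qed.

Lemma orb_curve_at_i Q W : Q = A + 'i *: B -> W = D + 'i *: E ->
  W *m Q = 'i%:M ->
  (pencil_det A B D E).['i] != 0 /\ orb_curve A B D E 'i = Q *m W.
Proof. by move=> -> -> WQ; rewrite pencil_detE; exact: orbmx_factor. Qed.

End DualCurve.

Lemma orb_curve_pairP (C : numClosedFieldType) (n m : nat)
    (A B A' B' : 'M[C]_(n, m)) (D E D' E' : 'M[C]_(m, n)) z :
  (pencil_det A B D E).[z] != 0 -> (pencil_det A' B' D' E').[z] != 0 ->
  [/\ curve_diff (fun w => (orb_curve A B D E w, orb_curve A' B' D' E' w)) z,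
    (Orb C n m `*` Orb C n m) (orb_curve A B D E z, orb_curve A' B' D' E' z),
    curve_diff (fun w => (dual_curve A B D E w, dual_curve A' B' D' E' w)) z^*
  & (Orb C n m `*` Orb C n m)
      (dual_curve A B D E z^*, dual_curve A' B' D' E' z^*)].
Proof.
move=> /orb_curveP[? ? ? ?] /orb_curveP[? ? ? ?].
by split; [exact: curve_diff_pair|split|exact: curve_diff_pair|split].
Qed.

Lemma common_nonroot (F : idomainType) (p q : {poly F}) (x : F) :
  p.[x] != 0 -> q.[x] != 0 ->
  exists2 d : {poly F}, d.[x] != 0 &
    forall z, d.[z] != 0 -> p.[z] != 0 /\ q.[z] != 0.
Proof.
move=> px qx; exists (p * q) => [|z]; rewrite hornerM; first exact: mulf_neq0.
by rewrite mulf_eq0 negb_or => /andP.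
Qed.

(** * Reality on the compact real-symplectic forms *)

Section Reality.
Variables (R : realType) (n m : nat).
Notation C := (R[i]).

Lemma fixed_conj_real (z : C) : z = Num.conj z -> z \is Num.real.
Proof. by move=> h; apply/CrealP. Qed.

(** Serves both fields: [eps] is [1] for the real and [-1] for the quaternionic structure. [Tm] is a
    structure of the same type on the space of dimension [m], without which the factors [Q] and [W]
    could not be split. *)
Lemma real_on_D_unit_H (T : 'M[C]_n) (Tm : 'M[C]_m) (eps : C)
    (H : {vspace 'cV[C]_n} * 'M[C]_n -> R) (HC : 'M[C]_n -> C) :
  cmxconj T = T -> T^t* *m T = 1%:M -> cmxconj Tm = Tm ->
  Num.conj eps = eps -> eps * eps = 1 -> T *m T = eps%:M -> Tm *m Tm = eps%:M ->
  holomorphic_on (Orb C n m) HC ->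
  (forall xi, D_H C n m T xi -> HC xi = (H (Phi xi))%:C) ->
  even_on (TGr_H C n m T) H ->
  forall xi, D_unit C n m xi -> HC xi \is Num.real.
Proof.
move=> Tr Tu Tmr er e2 TT TmTm hHC HCE Hev xi [[Q [W [WQ xiE]]] xiU].
have [A [B [QE hA hB]]] := real_decomposition Q Tr Tmr er e2 TT TmTm.
have [D [E [WE hD hE]]] := real_decomposition W Tmr Tr er e2 TmTm TT.
have [di ci] := orb_curve_at_i QE WE WQ.
have := @reflection_principle R _ (Orb C n m) HC (orb_curve A B D E)
  (dual_curve A B D E) (pencil_det A B D E) hHC di.
move=> /(_ (@orb_curveP _ _ _ A B D E)); rewrite dual_curveE ci -xiE xiU opprK.
(* As the involution fixes [xi], the reflected identity at ['i] says that [HC xi] is its own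
   conjugate; only the real parameters remain. *)
move=> h; apply/fixed_conj_real/h => t dt.
have ct : Num.conj t%:C = t%:C :> C by rewrite conjcE conjc_real.
rewrite -{2}ct dual_curveE; set x := orb_curve _ _ _ _ _.
have pencilT p q (X Y : 'M[C]_(p, q)) T1 T2 : X *m T2 = T1 *m cmxconj X ->
    Y *m T2 = T1 *m cmxconj Y ->
    (X + t%:C *: Y) *m T2 = T1 *m cmxconj (X + t%:C *: Y).
  move=> h1 h2; rewrite cmxconjD cmxconjZ ct mulmxDl mulmxDr -scalemxAl -scalemxAr.
  by rewrite h1 h2.
have dx : D_H C n m T x.
  have d0 := dt; rewrite pencil_detE in d0; apply: anticommute_D_H.
    exact: orbmx_Orb.
  by apply: (orbmx_anticommute d0); [exact: pencilT hA hB|exact: pencilT hD hE].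
have dx' := D_H_opp_adj Tu dx; have [ox _ _] := dx.
rewrite HCE// HCE// conjcE conjc_real Phi_opp_adj ?(Orb_sqr ox)//.
rewrite -Hev -?surjective_pairing//.
have tx := Phi_TGr_H Tu dx.
exact: tx.
Qed.

Lemma real_on_D_unit_C (H : {vspace 'cV[C]_n} * 'M[C]_n -> R)
    (HC : 'M[C]_n * 'M[C]_n -> C) :
  holomorphic_on (Orb C n m `*` Orb C n m) HC ->
  (forall xi, Orb C n m xi -> HC (xi, - cmxconj xi) = (H (Phi xi))%:C) ->
  even_on (TGr_C C n m) H ->
  forall xi1 xi2, D_unit C n m xi1 -> D_unit C n m xi2 ->
    HC (xi1, xi2) \is Num.real.
Proof.
move=> hHC HCE Hev xi1 xi2 [[Q1 [W1 [WQ1 xi1E]]] xi1U] [[Q2 [W2 [WQ2 xi2E]]] xi2U].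
have c2 : (2^-1 : C)^* = 2^-1 by apply: conj_Creal; rewrite realV realn.
(* Real and imaginary parts of the pair [(X, Y)] for the real structure
   [(X, Y) |-> (cmxconj Y, cmxconj X)]. At real parameters the second curve is then minus the
   conjugate of the first. *)
have split_conj p q (X Y : 'M[C]_(p, q)) : exists A B : 'M[C]_(p, q),
    X = A + 'i *: B /\ Y = cmxconj A + 'i *: cmxconj B.
  have h (a b : 'M[C]_(p, q)) : 2^-1 *: (a + b) + 2^-1 *: (a - b) = a.
    rewrite -scalerDr addrACA subrr addr0 scalerDr -scalerDl.
    by rewrite -[2^-1]mul1r -splitr scale1r.
  exists (2^-1 *: (X + cmxconj Y)), ((- 'i / 2) *: (X - cmxconj Y)); split.
    by rewrite scalerA mulrA mulrN -expr2 sqrCi opprK mul1r h.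
  rewrite !cmxconjZ c2 cmxconjD cmxconjK cmxconjD cmxconjN cmxconjK.
  rewrite rmorphM/= rmorphN/= conjCi c2 opprK scalerA mulrA -expr2 sqrCi mulN1r.
  by rewrite scaleNr -scalerN opprB addrC [cmxconj X + _]addrC addrC h.
have [A [B [Q1E Q2E]]] := split_conj _ _ Q1 Q2.
have [D [E [W1E W2E]]] := split_conj _ _ W1 W2.
have [A' A'E] : exists A', A' = cmxconj A by exists (cmxconj A).
have [B' B'E] : exists B', B' = cmxconj B by exists (cmxconj B).
have [D' D'E] : exists D', D' = cmxconj D by exists (cmxconj D).
have [E' E'E] : exists E', E' = cmxconj E by exists (cmxconj E).
rewrite -A'E -B'E in Q2E; rewrite -D'E -E'E in W2E.
have [d1i c1i] := orb_curve_at_i Q1E W1E WQ1.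
have [d2i c2i] := orb_curve_at_i Q2E W2E WQ2.
have [d di dE] := common_nonroot d1i d2i.
have := @reflection_principle R _ (Orb C n m `*` Orb C n m) HC
  (fun z => (orb_curve A B D E z, orb_curve A' B' D' E' z))
  (fun z => (dual_curve A B D E z, dual_curve A' B' D' E' z)) d hHC di.
rewrite /= !dual_curveE.
rewrite c1i c2i -xi1E -xi2E xi1U xi2U !opprK.
move=> h; apply/fixed_conj_real/h => [z|t].
  by move=> /dE[d1 d2]; exact: orb_curve_pairP d1 d2.
move=> /dE[d1 _].
have ct : Num.conj t%:C = t%:C :> C by rewrite conjcE conjc_real.
have c'E : orb_curve A' B' D' E' t%:C = - cmxconj (orb_curve A B D E t%:C).
  by rewrite /orb_curve orbmx_opp_conj !cmxconjD !cmxconjZ ct A'E B'E D'E E'E.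
rewrite -{3 4}ct !dual_curveE c'E; set x := orb_curve _ _ _ _ _.
have ox : Orb C n m x by apply: orbmx_Orb; rewrite -pencil_detE.
(* The involution, applied to both components, stays in the imaginary-symplectic form: it sends the
   point over [x] to the point over [- x^t*]. *)
have -> : (- cmxconj x)^t* = - (- cmxconj (- x^t*)).
  by rewrite adjmxN cmxconjN opprK adjmx_cmxconj.
rewrite opprK HCE// HCE; last exact: Orb_opp_adj.
rewrite conjcE conjc_real Phi_opp_adj ?(Orb_sqr ox)//.
rewrite -Hev -?surjective_pairing//.
exact: Phi_TGr_C.
Qed.

(** The standard symplectic matrix with blocks of size [m./2] supplies the structure on the source
    of [Q]. *)
Lemma even_quaternionic_structure : ~~ odd m -> exists Tm : 'M[C]_m,
  cmxconj Tm = Tm /\ Tm *m Tm = (-1)%:M.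
Proof.
move=> /even_halfK mE; have -> : m = (m./2 + m./2)%N by rewrite addnn mE.
exists (block_mx 0 1%:M (- 1%:M) 0); split.
  by rewrite /cmxconj map_block_mx !map_mx0 map_mxN map_mx1.
rewrite mulmx_block !mul0mx !mulmx0 !mulmx1 mul1mx !add0r !addr0.
by rewrite [RHS]scalar_mx_block raddfN.
Qed.

End Reality.

Unset Implicit Arguments.

Theorem theorem5p8 (R : realType) (m n : nat) (hmn : (1 <= m <= n)%N) :
  [/\
    (* F = R *)
    forall (H : {vspace 'cV[R[i]]_n} * 'M[R[i]]_n -> R)
           (HC : 'M[R[i]]_n -> R[i]),
      holomorphic_on (Orb R[i] n m) HC ->
      (forall xi, D_R R[i] n m xi -> HC xi = (H (Phi xi))%:C) ->
      even_on (TGr_R R[i] n m) H ->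
      forall xi, D_unit R[i] n m xi -> HC xi \is Num.real,
    (* F = H *)
    forall (J : 'M[R]_n),
      ~~ odd m -> ~~ odd n -> J^T = - J -> J *m J = - 1%:M ->
      let JJ : 'M[R[i]]_n := map_mx (real_complex R) J in
    forall (H : {vspace 'cV[R[i]]_n} * 'M[R[i]]_n -> R)
           (HC : 'M[R[i]]_n -> R[i]),
      holomorphic_on (Orb R[i] n m) HC ->
      (forall xi, D_H R[i] n m JJ xi -> HC xi = (H (Phi xi))%:C) ->
      even_on (TGr_H R[i] n m JJ) H ->
      forall xi, D_unit R[i] n m xi -> HC xi \is Num.real
  & (* F = C *)
    forall (H : {vspace 'cV[R[i]]_n} * 'M[R[i]]_n -> R)
           (HC : 'M[R[i]]_n * 'M[R[i]]_n -> R[i]),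
      holomorphic_on (Orb R[i] n m `*` Orb R[i] n m) HC ->
      (forall xi, Orb R[i] n m xi ->
         HC (xi, - cmxconj xi) = (H (Phi xi))%:C) ->
      even_on (TGr_C R[i] n m) H ->
      forall xi1 xi2, D_unit R[i] n m xi1 -> D_unit R[i] n m xi2 ->
        HC (xi1, xi2) \is Num.real].
Proof.
split.
- move=> H HC hHC HCE Hev.
  (* The real case is the one where the matrix of the structure is the identity. *)
  have quat1 : quat_map (1%:M : 'M[R[i]]_n) = @cmxconj _ n 1.
    by apply/funext => x; rewrite /quat_map mul1mx.
  have D1 xi : D_H R[i] n m 1%:M xi -> D_R R[i] n m xi.
    by rewrite /D_H /= quat1.
  have conj1 p : cmxconj (1%:M : 'M[R[i]]_p) = 1%:M by exact: map_mx1.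
  apply: (@real_on_D_unit_H R n m 1%:M 1%:M 1 H HC) => //.
  + by rewrite trmx1 map_mx1 mulmx1.
  + exact: conjC1.
  + by rewrite mulr1.
  + by rewrite mulmx1.
  + by rewrite mulmx1.
  + by move=> xi /D1; exact: HCE.
  + move=> Pi eta [[gr st] cov comm]; apply: Hev; split => //.
      by split => //; rewrite -quat1.
    (* Commuting with complex conjugation on vectors means that [eta] has real entries. *)
    apply: mulmx_colP => x; have := comm (cmxconj x).
    by rewrite quat1 cmxconjM cmxconjK /= => <-.
- move=> J em _ Jskew J2 JJ H HC hHC HCE Hev.
  have [Tm [Tmr Tm2]] := even_quaternionic_structure R em.
  have JJr : cmxconj JJ = JJ.
    by apply/matrixP => i j; rewrite !mxE conjcE conjc_real.
  have JJ2 : JJ *m JJ = (-1)%:M.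
    by rewrite -map_mxM J2 map_mxN map_mx1 raddfN.
  apply: (@real_on_D_unit_H R n m JJ Tm (-1) H HC) => //.
  + have -> : JJ^t* = - JJ.
      rewrite -map_mxN -Jskew; apply/matrixP => i j.
      by rewrite !mxE conjcE conjc_real.
    by rewrite mulNmx JJ2 raddfN opprK.
  + by apply: conj_Creal; rewrite realN real1.
  + by rewrite mulrNN mulr1.
- move=> H HC; exact: real_on_D_unit_C.
Qed.
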